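(* Let $C\subseteq\mathbb{P}^N(\overline{\mathbb{Q}}_p)$ be an irreducible smooth projective curve with good reduction, and let $\phi:C\to C$ be a morphism of good reduction with degree $d>1$. Then for every point $x\in C$ there is a constant $\kappa_x>0$ such that $$\Delta(x,y)\ge\left(\kappa_x|n|\right)^{1/n}$$ for every $n\ge 1$ and every $\phi$-periodic point $y\in C$ with $y\ne x$ of least period $n$.
   Context: $p$ is a prime, $\overline{\mathbb{Q}}_p$ is the algebraic closure of $\mathbb{Q}_p$, and $|\cdot|$ is the $p$-adic absolute value with $|p|=1/p$; in particular $|n|$ is the $p$-adic absolute value of the integer $n$. Put $O_p=\{z\in\overline{\mathbb{Q}}_p: |z|\le 1\}$, $\mathfrak{p}=\{z\in\overline{\mathbb{Q}}_p:|z|<1\}$, and identify $O_p/\mathfrak{p}$ with $\overline{\mathbb{F}}_p$. Homogeneous coordinates $X=(X_0,\dots,X_N)$ of a point $x=[X]\in\mathbb{P}^N(\overline{\mathbb{Q}}_p)$ are always chosen with $\max_i|X_i|=1$. The metric $\Delta$ is $\Delta([X],[Y])=\max_{i,j}|X_iY_j-X_jY_i|$. Good reduction of curves. Let $C\subseteq\mathbb{P}^N(\overline{\mathbb{Q}}_p)$ be an irreducible projective curve with homogeneous ideal of relations $I=I(C)$. Let $J=I\cap O_p[T_0,\dots,T_N]$ be generated by forms $f_1,\dots,f_t$. At a point $y=[Y]\in C$ with, say, $Y_0\ne0$ (similarly for another nonzero coordinate), $C$ is non-singular at $y$ if $\operatorname{rank}\left(\frac{\partial g_i}{\partial U_j}(y)\right)_{i,j}=N-1$,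 where $g_i(U_1,\dots,U_N)=f_i(1,U_1,\dots,U_N)$. $C$ is smooth if it is non-singular at every point. Let $\overline{J}\subset\overline{\mathbb{F}}_p[T_0,\dots,T_N]$ be the reduction of $J$ modulo $\mathfrak{p}$ and $\overline{C}\subset\mathbb{P}^N(\overline{\mathbb{F}}_p)$ the variety defined by $\overline{J}$. $C$ has good reduction if the same rank condition, for the reductions of the $g_i$ modulo $\mathfrak p$, holds at every $\bar y\in\overline{C}$. Good reduction of morphisms. A morphism $\phi:C\to C$ is given by forms $(F_0,\dots,F_N)$ of the same degree over $\overline{\mathbb{Q}}_p$, not all in $I$. Forms $(G_0,\dots,G_N)$ of equal degree represent $\phi$ if $F_iG_j-F_jG_i\in I$ for all $i,j$; being a morphism requires that at each $x=[X]\in C$ there is a representation with $(G_0(X),\dots,G_N(X))\neq 0$. $\phi$ has good reduction if for every $\bar x=[\bar X]\in\overline{C}$ there is a representation $(G_0,\dots,G_N)$ of $\phi$ with all $G_i\in O_p[T_0,\dots,T_N]$ such that the reductions $\overline{G}_i(\bar X)\in\overline{\mathbb{F}}_p$ are not all zero. The degree of $\phi$ is $[K:\phi^*(K)]$, where $K$ is the field of rational functions on $C$ and $\phi^*f=f\circ\phi$. A point $y$ is periodic if $\phi^n(y)=y$ for some $n\ge1$ (here $\phi^n$ is the $n$-th iterate), and has least period $n$ if moreover its orbit $\{y,\phi(y),\phi^2(y),\dots\}$ has cardinality $n$. *)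

(* Defs.v *)
From HB Require Import structures.
From mathcomp Require Import all_boot all_order all_algebra.
From mathcomp Require Import ring_quotient generic_quotient fraction mxpoly.
From mathcomp Require Import mpoly.
From mathcomp Require Import boolp classical_sets cardinality reals exp.
Set Implicit Arguments.
Unset Strict Implicit.
Unset Printing Implicit Defensive.
Import Order.TTheory GRing.Theory Num.Theory.
Local Open Scope classical_set_scope.
Local Open Scope card_scope.
Local Open Scope quotient_scope.
Local Open Scope ring_scope.

Record absval (R : realType) (F : fieldType) := AbsVal {
  av_fun :> F -> R;
  av_ge0 : forall x, 0 <= av_fun x;
  av_eq0 : forall x, av_fun x = 0 <-> x = 0;
  avM : forall x y, av_fun (x * y) = av_fun x * av_fun y;
  av_ultra : forall x y, av_fun (x + y) <= Num.max (av_fun x) (av_fun y)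
}.

Section ValuationRing.
Variables (R : realType) (F : fieldType) (v : absval R F).

Lemma av1 : v 1 = 1.
Proof.
have h : v 1 != 0 by apply/eqP => /av_eq0 /eqP; rewrite oner_eq0.
by apply: (mulfI h); rewrite -avM !mulr1.
Qed.

Lemma avN1 : v (-1) = 1.
Proof.
have : v (-1) ^+ 2 == 1 by rewrite expr2 -avM mulrNN mulr1 av1.
rewrite sqrf_eq1 => /orP[/eqP//|/eqP h].
by have := av_ge0 v (-1); rewrite h ler0N1.
Qed.

Definition integers : {pred F} := fun x => v x <= 1.

Lemma integers_subring : subring_closed integers.
Proof.
split=> [|x y|x y]; rewrite !unfold_in ?av1 // => hx hy.
  apply: le_trans (av_ultra _ _ _) _; rewrite ge_max hx /=.
  by rewrite -mulN1r avM avN1 mul1r.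
by rewrite avM mulr_ile1 ?av_ge0.
Qed.
HB.instance Definition _ :=
  GRing.isSubringClosed.Build F integers integers_subring.

Record valring := ValRing { valring_val : F; _ : valring_val \in integers }.
HB.instance Definition _ := [isSub for valring_val].
HB.instance Definition _ := [Choice of valring by <:].
HB.instance Definition _ := [SubChoice_isSubComNzRing of valring by <:].

(* [red] identifies the quotient of the valuation ring by its maximal ideal
   with [k]. *)
Definition is_residue_map (k : fieldType) (red : {rmorphism valring -> k}) :=
  (forall a, exists x, red x = a) /\ (forall x, red x = 0 <-> v (val x) < 1).

End ValuationRing.

Section PadicNumbers.
Variables (R : realType) (p : nat).

(* Since [denq q] and [numq q] are coprime, this is [p ^ - ord_p q]. *)
Definition padic_abs (q : rat) : R :=
  if q == 0 then 0
  else p%:R ^ ((logn p `|denq q|%N)%:Z - (logn p `|numq q|%N)%:Z).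

Definition complete_absval (F : fieldType) (w : absval R F) :=
  forall u : nat -> F,
    (forall e : R, 0 < e ->
       exists M, forall m n, (M <= m)%N -> (M <= n)%N -> w (u m - u n) < e) ->
    exists l, forall e : R, 0 < e ->
      exists M, forall n, (M <= n)%N -> w (u n - l) < e.

(* [Q] with [w] is the completion of the rational numbers for the p-adic
   absolute value. *)
Definition is_Qp (Q : fieldType) (w : absval R Q) :=
  [/\ forall q : rat, w (ratr q) = padic_abs q,
      forall (x : Q) (e : R), 0 < e -> exists q : rat, w (x - ratr q) < e
    & complete_absval w].

(* [K] is an algebraic closure of the field of p-adic numbers, and [v] extends
   the p-adic absolute value; such a [v] is unique. *)
Definition is_Qpbar (K : closedFieldType) (v : absval R K) :=
  exists (Q : fieldType) (w : absval R Q) (iota : {rmorphism Q -> K}),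
    [/\ is_Qp w, forall a, v (iota a) = w a & forall x, algebraicOver iota x].

End PadicNumbers.

Section ProjectiveSpace.
Variables (F : fieldType) (N : nat).

(* Points are lines in the space of vectors, so that equality of points is
   Leibniz equality. *)
Definition proj := {L : {vspace 'rV[F]_N.+1} | \dim L == 1%N}.

Definition hcoords (x : proj) (X : 'rV[F]_N.+1) := X \in val x /\ X != 0.

Definition is_form (f : {mpoly F[N.+1]}) := exists e, f \is e.-homog.

(* For a polynomial which is not a form this says that all its homogeneous
   components vanish at [x], if [F] is infinite. *)
Definition vanishes_at (f : {mpoly F[N.+1]}) (x : proj) :=
  forall X, hcoords x X -> f.@[X ord0] = 0.

Definition algebraic_set (Z : set proj) :=
  exists S : set {mpoly F[N.+1]},
    (forall f, S f -> is_form f) /\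
    Z = [set x | forall f, S f -> vanishes_at f x].

Definition irreducible_set (Z : set proj) :=
  [/\ algebraic_set Z, Z !=set0
    & forall A B, algebraic_set A -> algebraic_set B ->
        Z `<=` A `|` B -> Z `<=` A \/ Z `<=` B].

(* [has_dim] is the Krull dimension for the Zariski topology: the maximal
   length of a chain of irreducible closed subsets. *)
Definition irreducible_chain (Z : set proj) (n : nat) :=
  exists W : nat -> set proj,
    (forall i, (i <= n)%N -> irreducible_set (W i) /\ W i `<=` Z) /\
    (forall i, (i < n)%N -> W i `<` W i.+1).

Definition has_dim (Z : set proj) (n : nat) :=
  irreducible_chain Z n /\ ~ irreducible_chain Z n.+1.

End ProjectiveSpace.

Section Metric.
Variables (R : realType) (K : fieldType) (v : absval R K) (N : nat).

Definition unit_hcoords (x : proj K N) : set 'rV[K]_N.+1 :=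
  [set X | hcoords x X /\ \big[Num.max/0]_i v (X ord0 i) = 1].

(* The value does not depend on the choice of the normalized coordinates. *)
Definition Delta (x y : proj K N) : R :=
  let X := xget 0 (unit_hcoords x) in
  let Y := xget 0 (unit_hcoords y) in
  \big[Num.max/0]_i \big[Num.max/0]_j
    v (X ord0 i * Y ord0 j - X ord0 j * Y ord0 i).

End Metric.
Arguments unit_hcoords {R K} v {N} x.

Record curve (K : closedFieldType) (N : nat) := Curve {
  curve_pts :> proj K N -> Prop;
  curve_irr : irreducible_set curve_pts;
  curve_dim : has_dim curve_pts 1
}.

Definition vanishing_ideal (K : closedFieldType) (N : nat) (C : curve K N) :
    {pred {mpoly K[N.+1]}} :=
  fun f => `[< forall x, C x -> vanishes_at f x >].

Section VanishingIdeal.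
Variables (K : closedFieldType) (N : nat).
Implicit Types (f g : {mpoly K[N.+1]}) (X : 'rV[K]_N.+1) (x : proj K N).

Lemma videalP (C : curve K N) f :
  reflect (forall x, C x -> vanishes_at f x) (f \in vanishing_ideal C).
Proof. by rewrite unfold_in; exact: asboolP. Qed.

Lemma hcoords_ex x : exists X, hcoords x X.
Proof.
case: x => L hL; exists (vpick L); split; rewrite ?memv_pick //= vpick0.
by rewrite -dimv_eq0 (eqP hL).
Qed.

Lemma hcoordsZ x X t : hcoords x X -> t != 0 -> hcoords x (t *: X).
Proof.
by move=> [hX X0] t0; split; [rewrite memvZ | rewrite scaler_eq0 negb_or t0].
Qed.

Lemma hcoordsE x X Y :
  hcoords x X -> hcoords x Y -> exists2 t, t != 0 & Y = t *: X.
Proof.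
case: x => L hL [/= XL X0] [/= YL Y0].
have /eqP hLX : <[X]>%VS == L.
  by rewrite eqEdim -memvE XL dim_vline X0 (eqP hL).
move: YL; rewrite -hLX => /vlineP[t hY]; exists t => //.
by apply: contraNneq Y0 => t0; rewrite hY t0 scale0r.
Qed.

Definition on_line X f : {poly K} :=
  mmap (@polyC K) (fun i => X ord0 i *: 'X) f.

Lemma on_lineM X f g : on_line X (f * g) = on_line X f * on_line X g.
Proof. by rewrite /on_line rmorphM. Qed.

Lemma horner_on_line X f t : (on_line X f).[t] = f.@[(t *: X) ord0].
Proof.
rewrite /on_line /mmap mevalE horner_sum; apply: eq_bigr => m _.
rewrite hornerCM /mmap1 horner_prod; congr (_ * _).
by apply: eq_bigr => i _; rewrite horner_exp hornerZ hornerX mxE mulrC.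
Qed.

Lemma on_line_eq0 x X f : hcoords x X -> on_line X f = 0 <-> vanishes_at f x.
Proof.
move=> hX; split=> [f0 Y hY|hf].
  by have [t _ ->] := hcoordsE hX hY; rewrite -horner_on_line f0 horner0.
apply/eqP; apply: contraT => q0.
have /closed_rootP[t] : size ('X * on_line X f + 1) != 1%N.
  by rewrite mulrC -polyC1 size_MXaddC (negbTE q0) /= eqSS size_poly_eq0.
rewrite /root !hornerE horner_on_line.
have [->|t0] := eqVneq t 0; first by rewrite mul0r add0r oner_eq0.
by rewrite (hf _ (hcoordsZ hX t0)) mulr0 add0r oner_eq0.
Qed.

Lemma vanishes_atM x f g :
  vanishes_at (f * g) x -> vanishes_at f x \/ vanishes_at g x.
Proof.
have [X hX] := hcoords_ex x.
move=> /(on_line_eq0 _ hX); rewrite on_lineM => /eqP.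
by rewrite mulf_eq0 => /orP[]/eqP/(on_line_eq0 _ hX); [left|right].
Qed.

Lemma on_line_homog X f e :
  f \is e.-homog -> on_line X f = f.@[X ord0] *: 'X^e.
Proof.
move=> /dhomogP hf; rewrite /on_line /mmap mevalE scaler_suml.
rewrite big_seq [RHS]big_seq; apply: eq_bigr => m hm.
rewrite mul_polyC -scalerA; congr (_ *: _).
rewrite /mmap1 (eq_bigr (fun i => (X ord0 i ^+ m i)%:P * 'X^(m i))); last first.
  by move=> i _; rewrite exprZn mul_polyC.
by rewrite big_split /= prodrXr -mdegE hf // -rmorph_prod mul_polyC.
Qed.

Lemma vanishes_at_pihomog x f :
  vanishes_at f x <-> forall e, vanishes_at (pihomog mdeg e f) x.
Proof.
have [X hX] := hcoords_ex x.
split=> [/(on_line_eq0 _ hX) h e|h Y hY]; last first.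
  rewrite (pihomog_partitionE (leqnn (msize f))) raddf_sum big1 // => i _.
  exact: h.
apply/(on_line_eq0 _ hX); rewrite (on_line_homog _ (pihomogP _ e _)).
have lte : (e < maxn (msize f) e.+1)%N by rewrite leq_maxr.
move: h; rewrite (pihomog_partitionE (leq_maxl (msize f) e.+1)).
rewrite /on_line raddf_sum /= -(pihomog_partitionE (leq_maxl (msize f) e.+1)).
move/(congr1 (fun q : {poly K} => q`_e)); rewrite coef0 coef_sum.
under eq_bigr => i _.
  rewrite -/(on_line X _) (on_line_homog _ (pihomogP _ i _)) coefZ coefXn.
  over.
rewrite (bigD1 (Ordinal lte)) //= eqxx mulr1 big1 ?addr0 => [->|i ie].
  by rewrite scale0r.
by rewrite -val_eqE /= eq_sym in ie; rewrite (negbTE ie) mulr0.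
Qed.

Lemma algebraic_setI (C : set (proj K N)) f :
  algebraic_set C -> algebraic_set (C `&` [set x | vanishes_at f x]).
Proof.
move=> [S [hS ->]].
exists (S `|` [set g | exists e, g = pihomog mdeg e f]); split.
  by move=> g [/hS//|[e ->]]; exists e; exact: pihomogP.
rewrite eqEsubset; split=> x /=.
  by move=> [h1 h2] g [/h1//|[e ->]]; move/vanishes_at_pihomog: h2; exact.
move=> h; split; first by move=> g Sg; apply: h; left.
by apply/vanishes_at_pihomog => e; apply: h; right; exists e.
Qed.

Variable C : curve K N.

Lemma videal_closed : idealr_closed (vanishing_ideal C).
Proof.
split.
- by apply/videalP => x _ X _; rewrite meval0.
- have [_ [x Cx] _] := curve_irr C.
  apply/negP => /videalP/(_ x Cx) h; have [X hX] := hcoords_ex x.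
  by have := h _ hX; rewrite meval1 => /eqP; rewrite oner_eq0.
- move=> a f g /videalP hf /videalP hg; apply/videalP => x Cx X hX.
  by rewrite mevalD mevalM (hf _ Cx _ hX) (hg _ Cx _ hX) mulr0 addr0.
Qed.

Lemma videal_prime : prime_idealr_closed (vanishing_ideal C).
Proof.
move=> f g /videalP hfg.
have [Calg _ Cirr] := curve_irr C.
have := Cirr _ _ (algebraic_setI f Calg) (algebraic_setI g Calg).
case=> [x Cx|h|h].
- by have [hx|hx] := vanishes_atM (hfg _ Cx); [left|right].
- by apply/orP; left; apply/videalP => x /h[].
- by apply/orP; right; apply/videalP => x /h[].
Qed.

HB.instance Definition _ :=
  isIdealr.Build {mpoly K[N.+1]} (vanishing_ideal C) videal_closed.
HB.instance Definition _ :=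
  isPrimeIdealrClosed.Build {mpoly K[N.+1]} (vanishing_ideal C) videal_prime.

End VanishingIdeal.

Section FunctionField.
Variables (K : closedFieldType) (N : nat) (C : curve K N).

Definition coord_ring := {ideal_quot (vanishing_ideal C)}.
HB.instance Definition _ := GRing.ComNzRing.on coord_ring.

Definition coord_unit : pred coord_ring :=
  fun x => `[< exists y, y * x = 1 >].
Definition coord_inv (x : coord_ring) : coord_ring :=
  xget x [set y | y * x = 1].

Lemma coord_mulVr : {in coord_unit, left_inverse 1 coord_inv *%R}.
Proof.
move=> x /asboolP[y yx].
by have := xgetPex x (ex_intro [set y | y * x = 1] y yx).
Qed.

Lemma coord_unitP (x y : coord_ring) : y * x = 1 -> coord_unit x.
Proof. by move=> yx; apply/asboolP; exists y. Qed.

Lemma coord_inv_out : {in [predC coord_unit], coord_inv =1 id}.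
Proof.
move=> x /asboolP hx; rewrite /coord_inv.
by case: xgetP => // y _ yx; case: hx; exists y.
Qed.

HB.instance Definition _ := GRing.ComNzRing_hasMulInverse.Build coord_ring
  coord_mulVr coord_unitP coord_inv_out.
HB.instance Definition _ := GRing.ComUnitRing_isIntegral.Build coord_ring
  (@Quotient.rquot_IdomainAxiom _ (vanishing_ideal C)).

Definition coord_class (a : {mpoly K[N.+1]}) : coord_ring :=
  \pi_{ideal_quot (vanishing_ideal C)} a.

(* The class of [a / b], for [b] outside the ideal of the curve. *)
Definition class_frac (a b : {mpoly K[N.+1]}) : {fraction coord_ring} :=
  tofrac (coord_class a) / tofrac (coord_class b).

Definition function_field : set {fraction coord_ring} :=
  [set h | exists e a b, [/\ a \is e.-homog, b \is e.-homog,
     b \notin vanishing_ideal C & h = class_frac a b]].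

End FunctionField.
Arguments function_field {K N} C.

Section Morphisms.
Variables (K : closedFieldType) (N : nat) (C : curve K N).
Implicit Types F G : {ffun 'I_N.+1 -> {mpoly K[N.+1]}}.

Definition same_degree_forms F := exists e, forall i, F i \is e.-homog.

Definition represents F G :=
  same_degree_forms G /\
  forall i j, F i * G j - F j * G i \in vanishing_ideal C.

(* Only the values of [mor_fun] on the points of [C] are constrained. *)
Record self_morphism := SelfMorphism {
  mor_forms : {ffun 'I_N.+1 -> {mpoly K[N.+1]}};
  mor_fun :> proj K N -> proj K N;
  mor_homog : same_degree_forms mor_forms;
  mor_notin : exists i, mor_forms i \notin vanishing_ideal C;
  mor_stable : forall x, C x -> C (mor_fun x);
  mor_repr : forall x, C x -> exists2 G, represents mor_forms G &
    forall X, hcoords x X ->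
      hcoords (mor_fun x) (\row_i (G i).@[X ord0])
}.

Definition subst_forms F (a : {mpoly K[N.+1]}) : {mpoly K[N.+1]} :=
  a \mPo [tuple F i | i < N.+1].

(* For a constant morphism, [f \o phi] is only defined for those [f] which are
   regular at its value. *)
Definition pullback_field (phi : self_morphism) :
    set {fraction (coord_ring C)} :=
  [set h | exists e a b, [/\ a \is e.-homog, b \is e.-homog,
     b \notin vanishing_ideal C,
     subst_forms (mor_forms phi) b \notin vanishing_ideal C
   & h = class_frac C (subst_forms (mor_forms phi) a)
                      (subst_forms (mor_forms phi) b)]].

End Morphisms.
Arguments pullback_field {K N C} phi.

(* [b] is a basis of the field [L] over its subfield [A]. *)
Definition ext_degree (E : fieldType) (L A : set E) (d : nat) :=
  exists2 b : {ffun 'I_d -> E}, (forall i, L (b i)) &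
    forall x, L x -> exists! c : {ffun 'I_d -> E},
      (forall i, A (c i)) /\ x = \sum_i c i * b i.

Definition mor_degree (K : closedFieldType) (N : nat) (C : curve K N)
    (phi : self_morphism C) (d : nat) :=
  ext_degree (function_field C) (pullback_field phi) d.

Definition least_period (T : Type) (phi : T -> T) (y : T) (n : nat) :=
  [/\ (0 < n)%N, iter n phi y = y
    & range (fun m => iter m phi y) #= `I_n].

Section Reduction.
Variables (A : comNzRingType) (N : nat).

Definition dehom (k : 'I_N.+1) (f : {mpoly A[N.+1]}) : {mpoly A[N]} :=
  f \mPo [tuple (if unlift k i is Some j then 'X_j else 1) | i < N.+1].

(* [h] is the inclusion of the ring of integers in the field for the
   condition on the curve, and the residue map for that on its reduction. *)
Definition nonsingular_at (E : fieldType) (h : {rmorphism A -> E}) (t : nat)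
    (f : 'I_t -> {mpoly A[N.+1]}) (y : proj E N) :=
  forall Y k, hcoords y Y -> Y ord0 k != 0 ->
    \rank (\matrix_(i < t, j < N)
      (map_mpoly h (dehom k (f i)))^`M(j).@[fun l =>
         Y ord0 (lift k l) / Y ord0 k]) = (N - 1)%N.

Definition generated_by_forms (J : set {mpoly A[N.+1]}) (t : nat)
    (f : 'I_t -> {mpoly A[N.+1]}) :=
  (forall i, exists e, f i \is e.-homog) /\
  forall g, J g <-> exists c : 'I_t -> {mpoly A[N.+1]}, g = \sum_i c i * f i.

End Reduction.

Section GoodReduction.
Variables (R : realType) (K : closedFieldType) (v : absval R K).
Variables (k : fieldType) (red : {rmorphism valring v -> k}).
Variables (N : nat) (C : curve K N).

Definition integral_ideal : set {mpoly (valring v)[N.+1]} :=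
  [set g | map_mpoly val g \in vanishing_ideal C].

Definition reduced_curve : set (proj k N) :=
  [set y | forall g, integral_ideal g -> vanishes_at (map_mpoly red g) y].

Variables (t : nat) (f : 'I_t -> {mpoly (valring v)[N.+1]}).

Definition smooth_curve :=
  forall y, C y -> nonsingular_at (\val : {rmorphism valring v -> K}) f y.

Definition curve_good_reduction :=
  forall y, reduced_curve y -> nonsingular_at red f y.

Definition mor_good_reduction (phi : self_morphism C) :=
  forall x, reduced_curve x ->
    exists2 G : {ffun 'I_N.+1 -> {mpoly (valring v)[N.+1]}},
      represents C (mor_forms phi) [ffun i => map_mpoly val (G i)] &
      forall X, hcoords x X -> exists i, (map_mpoly red (G i)).@[X ord0] != 0.

End GoodReduction.
Arguments integral_ideal {R K} v {N} C.
Arguments reduced_curve {R K v k} red {N} C.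

(* Main.v *)
Require Import Defs.
From HB Require Import structures.
From mathcomp Require Import all_boot all_order all_algebra.
From mathcomp Require Import ring_quotient generic_quotient fraction.
From mathcomp Require Import mpoly.
From mathcomp Require Import boolp classical_sets cardinality reals exp.
From mathcomp Require Import ring lra zify.
Set Implicit Arguments.
Unset Strict Implicit.
Unset Printing Implicit Defensive.
Import Order.TTheory GRing.Theory Num.Theory.
Local Open Scope classical_set_scope.
Local Open Scope quotient_scope.
Local Open Scope ring_scope.

(** The idea. Points of the curve with the same reduction as [x] form a
  residue disc [D]. Smoothness of the reduced curve provides a parameter [u]
  on [D] such that every function [G] in the local ring of the integral model
  satisfies [G z - G y = (u z - u y) * H z] with [H] in the same ring
  ([regular_div], from [chart_parameter]). This divisibility replaces power
  series and Weierstrass preparation: a function [Z] of the ring vanishing at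
  distinct points [y_1, .., y_r] is the product of the [u - u y_i] and of an
  integral function ([dr_factor_zeros]), so that [|Z x|] is at most the
  product of the [|u x - u y_i|]. Good reduction of the morphism says that it
  carries residue discs to residue discs and pulls the local rings back to
  each other ([morphism_residue_pullback]).

  Suppose first that the centre [x0] of the disc is periodic, and let [psi] be
  an iterate of the morphism fixing it, with multiplier [lam]. If [y] has
  exact period [r] for [psi], its orbit consists of [r] points of [D] at
  distance at most [|u y|] from [x0]. A function [Z] of the ring vanishing on
  this orbit therefore gives [|Z x0| <= |u y| ^ r], and it remains to choose
  [Z] with [|Z x0|] bounded below independently of [r] and [y]. Unless
  [lam ^ r] is close to [1], one takes the displacement
  [u (psi^r z) - u z] divided by [u]. Otherwise [r] is a multiple [s * e] of a
  fixed [s]. If [p] divides [e], one divides the displacement of [psi^r] by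
  that of [psi^(r/p)], which does not vanish on the orbit; the value at [x0]
  has absolute value [|p|]. If [p] does not divide [e], one divides the
  displacement of [psi^r] by the power of [u] which divides the displacement
  of [psi^s]; the value at [x0] is, up to a unit, a non-zero constant depending
  on [s] only. This is [dr_fixed_point_bound].

  If [x] is not periodic but its disc contains a periodic point [x0], then a
  periodic point [y] closer to [x] than [x0] is at the same distance from [x0]
  as [x], which bounds its period; and a point of period [r] cannot be closer
  to [x] than the [r]-th iterate of [x] is ([dr_periodic_bound]).

  All this requires that no iterate [psi^s] be the identity on [D]. If one is,
  then either [D] is finite, and the bound is trivial, or an iterate of the
  morphism fixes infinitely many points of the curve. Since proper closed
  subsets of a curve are finite ([curve_zeros_finite], by Hilbert's basis
  theorem and the dimension), this iterate then acts trivially on the function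
  field, and the morphism has degree one ([finite_order_degree_le1]).

  The constant so obtained bounds [|u y - u x| ^ r] for the period [r] of [y]
  under [psi = phi^m]. The period [n] under the morphism satisfies [n <= r * m]
  with [m] fixed, hence the constant survives, to the power [m], for [n]. *)

(** * Non-archimedean absolute values *)

Section AbsoluteValue.
Variables (R : realType) (F : fieldType) (v : absval R F).
Implicit Types x y : F.

Lemma av0 : v 0 = 0.
Proof. by apply/av_eq0. Qed.

Lemma av_gt0 x : (0 < v x) = (x != 0).
Proof.
rewrite lt0r av_ge0 andbT; congr (~~ _).
by apply/eqP/eqP => [/av_eq0|->]; rewrite ?av0.
Qed.

Lemma avN x : v (- x) = v x.
Proof. by rewrite -mulN1r avM avN1 mul1r. Qed.

Lemma avB x y : v (x - y) <= Num.max (v x) (v y).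
Proof. by rewrite -(avN y); exact: av_ultra. Qed.

Lemma av_distC x y : v (x - y) = v (y - x).
Proof. by rewrite -avN opprB. Qed.

Lemma avV x : v x^-1 = (v x)^-1.
Proof.
have [->|x0] := eqVneq x 0; first by rewrite invr0 av0 invr0.
have vx0 : v x != 0 by rewrite gt_eqF ?av_gt0.
by apply: (mulfI vx0); rewrite -avM !mulfV // av1.
Qed.

Lemma avX x n : v (x ^+ n) = v x ^+ n.
Proof. by elim: n => [|n IHn]; rewrite ?expr0 ?av1 // !exprS avM IHn. Qed.

Lemma av_prod (I : Type) (r : seq I) (f : I -> F) :
  v (\prod_(i <- r) f i) = \prod_(i <- r) v (f i).
Proof. by elim/big_rec2: _ => [|i a b _ <-]; rewrite ?av1 ?avM. Qed.

Lemma av_sum_lt (I : Type) (r : seq I) (f : I -> F) (c : R) :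
  0 < c -> (forall i, v (f i) < c) -> v (\sum_(i <- r) f i) < c.
Proof.
move=> c0 hf; elim/big_ind: _ => [|a b ha hb|i _]; rewrite ?av0 //.
by apply: le_lt_trans (av_ultra _ _ _) _; rewrite gt_max ha.
Qed.

Lemma av_sum_le (I : Type) (r : seq I) (f : I -> F) (c : R) :
  0 <= c -> (forall i, v (f i) <= c) -> v (\sum_(i <- r) f i) <= c.
Proof.
move=> c0 hf; elim/big_ind: _ => [|a b ha hb|i _]; rewrite ?av0 //.
by apply: le_trans (av_ultra _ _ _) _; rewrite ge_max ha.
Qed.

Lemma avD_strict x y : v y < v x -> v (x + y) = v x.
Proof.
move=> lyx; apply/eqP; rewrite eq_le; apply/andP; split.
  by apply: le_trans (av_ultra _ _ _) _; rewrite ge_max lexx ltW.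
have := avB (x + y) y; rewrite addrK le_max => /orP[//|].
by rewrite leNgt lyx.
Qed.

Lemma av_nat_le1 n : v n%:R <= 1.
Proof.
elim: n => [|n IHn]; first by rewrite av0.
by rewrite -natr1; apply: le_trans (av_ultra _ _ _) _; rewrite ge_max IHn av1 /=.
Qed.

End AbsoluteValue.

Section ValuationRingElements.
Variables (R : realType) (F : fieldType) (v : absval R F).
Local Notation O := (valring v).
Implicit Types a b : O.

Lemma valring_le1 a : v (val a) <= 1.
Proof. by have := valP a; rewrite unfold_in. Qed.

Lemma valring_mul_eq0 a b : a * b = 0 -> a = 0 \/ b = 0.
Proof.
move=> /(congr1 val); rewrite rmorphM /= => /eqP.
by rewrite mulf_eq0 => /orP[] /eqP h; [left|right]; apply: val_inj; exact: h.
Qed.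

Lemma valring_mulfI a b c : a != 0 -> a * b = a * c -> b = c.
Proof.
move=> a0 h; apply/eqP; rewrite -subr_eq0; apply/eqP.
have : a * (b - c) = 0 by rewrite mulrBr h subrr.
by case/valring_mul_eq0 => // /eqP; rewrite (negbTE a0).
Qed.

Lemma valring_gt0 a : (0 < v (val a)) = (a != 0).
Proof. by rewrite av_gt0 -(inj_eq val_inj). Qed.

End ValuationRingElements.

(** The sum is [(t ^+ e - 1) / (t - 1)]; all its terms are congruent to [1]
  modulo [t - 1], hence the sum to [e]. *)
Lemma av_sum_powers (R : realType) (F : fieldType) (v : absval R F) (t : F) e :
  v t <= 1 -> v (t - 1) < v e%:R -> v (\sum_(j < e) t ^+ j) = v e%:R.
Proof.
move=> t1 hte.
have -> : \sum_(j < e) t ^+ j = e%:R + \sum_(j < e) (t ^+ j - 1).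
  by rewrite sumrB sumr_const card_ord addrC subrK.
apply: avD_strict; apply: av_sum_lt => [|j].
  exact: le_lt_trans (av_ge0 _ _) hte.
apply: le_lt_trans hte; rewrite subrX1 avM ler_piMr ?av_ge0 //.
by apply: av_sum_le => // i; rewrite avX exprn_ile1 ?av_ge0.
Qed.

(** Used to exclude functions divisible by all powers of the parameter of a
  disc, and to bound the periods of the points at a given distance from a
  periodic point. *)
Lemma expr_lt_eventually (R : realType) (q e : R) :
  0 <= q < 1 -> 0 < e -> exists n0, forall n, (n0 <= n)%N -> q ^+ n < e.
Proof.
move=> /andP[q0 q1] e0.
have [->|qn0] := eqVneq q 0.
  by exists 1%N => -[//|n] _; rewrite expr0n.
have qgt0 : 0 < q by rewrite lt0r qn0.
pose b := q^-1 - 1; have b0 : 0 < b by rewrite subr_gt0 invf_gt1.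
have bern n : 1 + b *+ n <= q^-1 ^+ n.
  elim: n => [|n IHn]; first by rewrite mulr0n addr0 expr0.
  rewrite exprSr; apply: le_trans (_ : (1 + b *+ n) * q^-1 <= _); last first.
    by apply: ler_wpM2r => //; rewrite invr_ge0.
  have -> : q^-1 = 1 + b by rewrite /b addrC subrK.
  rewrite mulrDr mulr1 mulrDl mul1r mulrSr -addrA lerD2l lerD2l lerDl.
  by rewrite mulr_ge0 ?mulrn_wge0 ?ltW.
have einv : 0 <= e^-1 / b by rewrite divr_ge0 ?invr_ge0 ?ltW.
have := archi_boundP einv; set n0 := Num.bound _ => hn0.
exists n0 => n ln; rewrite -ltf_pV2 ?posrE ?exprn_gt0 // -exprVn.
apply: lt_le_trans (bern n); rewrite -mulr_natr.
have : e^-1 < n0%:R * b by rewrite -ltr_pdivrMr.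
have : n0%:R * b <= b * n%:R by rewrite mulrC ler_pM2l // ler_nat.
lra.
Qed.

Lemma finite_positive_lower_bound (R : realType) (T : eqType) (A : set T) (f : T -> R) :
  finite_set A -> (forall y, A y -> 0 < f y) ->
  exists2 c, 0 < c & forall y, A y -> c <= f y.
Proof.
move=> /finite_seqP[s ->]; elim: s => [|a s IHs] hf; first by exists 1.
have [c c0 hc] := IHs (fun y hy => hf y (mem_behead (s := a :: s) hy)).
exists (Num.min c (f a)); first by rewrite lt_min c0; apply: hf; exact: mem_head.
move=> y /=; rewrite inE ge_min => /orP[/eqP->|/hc->//].
by rewrite lexx orbT.
Qed.

(** * Exact periods *)

Section LeastPeriod.
Variables (T : Type) (psi : T -> T).

Definition exact_period (y : T) (r : nat) :=
  [/\ (0 < r)%N, iter r psi y = y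
    & forall j, (0 < j < r)%N -> iter j psi y <> y].

Lemma exact_period_shift y r i j : exact_period y r -> (i <= r)%N ->
  iter j psi (iter i psi y) = iter i psi y -> iter j psi y = y.
Proof.
move=> [_ hr _] ir /(congr1 (iter (r - i) psi)).
have -> : iter (r - i) psi (iter j psi (iter i psi y)) = iter j psi y.
  by rewrite -!iterD (_ : _ + i = j + r)%N ?iterD ?hr //; lia.
by rewrite -iterD subnK // hr.
Qed.

Lemma exact_period_orbit_inj y r i j : exact_period y r ->
  (i < j)%N -> (j < r)%N -> iter i psi y <> iter j psi y.
Proof.
move=> hy lij ljr e; have [_ _ hmin] := hy.
apply: (hmin (j - i)%N); first by rewrite subn_gt0 lij (leq_ltn_trans (leq_subr _ _)).
apply: (exact_period_shift (i := i) hy); first by lia.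
by rewrite -iterD subnK // ltnW.
Qed.

Lemma exact_period_exists y n : (0 < n)%N -> iter n psi y = y ->
  exists2 r, exact_period y r & (r <= n)%N.
Proof.
move=> n0 hn; have ex : exists r, (0 < r)%N && `[< iter r psi y = y >].
  by exists n; rewrite n0; apply/asboolP.
case: (ex_minnP ex) => r /andP[r0 /asboolP hr] hmin.
exists r; last by apply: hmin; rewrite n0; apply/asboolP.
split=> // j /andP[j0 jr] hj.
by have := hmin j; rewrite j0 leqNgt jr => /(_ (introT (asboolP _) hj)).
Qed.

End LeastPeriod.

(** * Rings of functions on a disc with a parameter *)

Section Disc.
Variables (R : realType) (F : fieldType) (v : absval R F).
Local Notation O := (valring v).
Local Notation nrm a := (v (val a)).
Variable T : Type.

(** The maps compatible with the local ring [A] of integral functions on the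
  disc [D], such as the constant maps and the iterates of a map of good
  reduction. *)
Definition admissible (D : set T) (A : (T -> O) -> Prop) (a : T -> T) :=
  (forall z, D z -> D (a z)) /\ forall G, A G -> A (G \o a).

(** The properties of the local ring of a smooth integral curve at a point of
  its special fibre, seen as a ring of functions on the residue disc, that
  replace expansions in power series of the parameter [u]. Stating [dr_div]
  for all admissible maps covers both division by [u - u c] (constant maps)
  and division by the displacement of a dynamical system. *)
Record disc_ring (D : set T) (A : (T -> O) -> Prop) (u : T -> O) : Prop := {
  dr_const : forall c, A (fun=> c);
  dr_add : forall G H, A G -> A H -> A (fun z => G z + H z);
  dr_mul : forall G H, A G -> A H -> A (fun z => G z * H z);
  dr_ext : forall G H, (forall z, D z -> G z = H z) -> A G -> A H;
  dr_par : A u;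
  dr_lt1 : forall y z, D y -> D z -> nrm (u y - u z) < 1;
  dr_inj : forall y z, D y -> D z -> u y = u z -> y = z;
  dr_div : forall a G, admissible D A a -> A G ->
    exists2 H, A H & forall z, D z -> G (a z) - G z = (u (a z) - u z) * H z
}.

Variables (D : set T) (A : (T -> O) -> Prop) (u : T -> O).
Hypothesis disc : disc_ring D A u.

Lemma dr_sub G H : A G -> A H -> A (fun z => G z - H z).
Proof.
move=> hG hH; apply: (dr_ext disc _ (dr_add disc hG
  (dr_mul disc (dr_const disc (-1)) hH))) => z _.
by rewrite mulN1r.
Qed.

Lemma admissible_id : admissible D A id.
Proof. by split. Qed.

Lemma admissible_comp a b :
  admissible D A a -> admissible D A b -> admissible D A (a \o b).
Proof.
move=> [ha1 ha2] [hb1 hb2]; split=> [z hz|G hG]; first exact/ha1/hb1.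
exact: hb2 (ha2 _ hG).
Qed.

Lemma admissible_iter a n : admissible D A a -> admissible D A (iter n a).
Proof.
move=> ha; elim: n => [|n IHn]; first exact: admissible_id.
exact: admissible_comp ha IHn.
Qed.

Lemma dr_div_point c G : D c -> A G ->
  exists2 H, A H & forall z, D z -> G z - G c = (u z - u c) * H z.
Proof.
move=> hc hG; have hcst : admissible D A (fun=> c).
  by split=> // G' hG'; exact: dr_const disc (G' c).
have [H hH hdiv] := dr_div disc hcst hG; exists H => // z hz.
by rewrite -opprB hdiv // -mulNr opprB.
Qed.

Lemma dr_lipschitz G y z : A G -> D y -> D z ->
  nrm (G y - G z) <= nrm (u y - u z).
Proof.
move=> hG hy hz; have [H _ hdiv] := dr_div_point hz hG.
by rewrite hdiv // rmorphM avM ler_piMr ?av_ge0 ?valring_le1.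
Qed.

(** The substitute for Weierstrass preparation. The zeros are divided out one
  after the other; injectivity of [u] keeps the linear factors already found
  from vanishing at the next zero. *)
Lemma dr_factor_zeros (r : nat) (y : nat -> T) Z : A Z ->
  (forall i, (i < r)%N -> D (y i) /\ Z (y i) = 0) ->
  (forall i j, (i < j)%N -> (j < r)%N -> y i <> y j) ->
  exists2 H, A H &
    forall z, D z -> Z z = (\prod_(i < r) (u z - u (y i))) * H z.
Proof.
move=> hZ; elim: r => [|r IHr] hy yinj.
  by exists Z => // z _; rewrite big_ord0 mul1r.
have [H hH eZ] := IHr (fun i hi => hy i (ltnW hi))
  (fun i j hij hj => yinj i j hij (ltnW hj)).
have [Dr Zr] := hy r (ltnSn r).
have Hr : H (y r) = 0.
  move: Zr; rewrite eZ // => /valring_mul_eq0[/(congr1 val)|//].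
  rewrite rmorph_prod /= => /eqP/prodf_eq0[i _].
  rewrite subr_eq0 => /eqP /val_inj e.
  case: (yinj i r (ltn_ord i) (ltnSn r)).
  by apply: dr_inj disc _ _ _ Dr _ => //; case: (hy i (ltnW (ltn_ord i))).
have [H' hH' eH] := dr_div_point Dr hH; exists H' => // z hz.
by rewrite big_ord_recr /= -mulrA -eH // Hr subr0 eZ.
Qed.

(** * Maps fixing the centre of a disc *)

Variable x0 : T.
Hypotheses (Dx0 : D x0) (ux0 : u x0 = 0).

(** The chain rule along the orbit of [h], for the parameter as well as for the
  displacement of [h]. *)
Lemma dr_cocycle h w G : admissible D A h -> h x0 = x0 -> A G ->
  (forall z, D z -> w (h z) = w z * G z) ->
  forall j, exists P, [/\ A P, P x0 = G x0 ^+ j &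
    forall z, D z -> w (iter j h z) = w z * P z].
Proof.
move=> hh hx hG hw; elim=> [|j [P [hP Px eP]]].
  by exists (fun=> 1); split=> [||z hz]; [exact: (dr_const disc)|by []|by rewrite mulr1].
have [hj hAj] := admissible_iter j hh.
exists (fun z => P z * G (iter j h z)); split=> [||z hz].
- exact: (dr_mul disc hP (hAj _ hG)).
- by rewrite Px iter_fix // exprSr.
- by rewrite iterS hw ?eP ?mulrA //; exact: hj.
Qed.

Lemma dr_multiplier h : admissible D A h -> h x0 = x0 ->
  exists2 M, A M & forall z, D z -> u (h z) = u z * M z.
Proof.
move=> [_ hA] hx; have [M hM eM] := dr_div_point Dx0 (hA _ (dr_par disc)).
by exists M => // z /eM; rewrite /= hx ux0 !subr0.
Qed.

(** The quotient is built explicitly, because its value at the centre cannot be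
  recovered by cancelling the displacement: nothing ensures that the disc has
  points close to its centre. *)
Lemma dr_displacement h M e : admissible D A h -> h x0 = x0 ->
  A M -> (forall z, D z -> u (h z) = u z * M z) ->
  exists Q, [/\ A Q, Q x0 = \sum_(j < e) M x0 ^+ j &
    forall z, D z -> u (iter e h z) - u z = (u (h z) - u z) * Q z].
Proof.
move=> hh hx hM eM; have [hD hA] := hh.
have [H hH eH] := dr_div disc hh hM.
pose w z := u (h z) - u z.
pose G z := M (h z) + u z * H z.
have hG : A G.
  exact: (dr_add disc (hA _ hM) (dr_mul disc (dr_par disc) hH)).
have wG z : D z -> w (h z) = w z * G z.
  move=> hz; rewrite /w /G mulrDr [_ * (u z * _)]mulrCA -eH //.
  by rewrite [u (h (h z))]eM ?[in u (h z)]eM //; [ring|exact: hD].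
elim: e => [|e [Q [hQ Qx eQ]]].
  exists (fun=> 0); split=> [||z _]; [exact: (dr_const disc)|by rewrite big_ord0|].
  by rewrite mulr0 /= subrr.
have [P [hP Px eP]] := dr_cocycle hh hx hG wG e.
exists (fun z => Q z + P z); split=> [||z hz]; first exact: (dr_add disc).
  by rewrite big_ord_recr /= Qx Px /G hx ux0 mul0r addr0.
by rewrite mulrDr -eQ // -(eP z hz) /w /=; ring.
Qed.

(** Since [|u| < 1] on the disc, a function divisible by all powers of [u]
  vanishes identically there. *)
Lemma dr_order W : A W -> (exists2 z, D z & W z <> 0) ->
  exists m Wm, [/\ A Wm, Wm x0 <> 0 & forall z, D z -> W z = u z ^+ m * Wm z].
Proof.
move=> hW [z hz Wz]; apply: contrapT => hn.
have hm m : exists2 Wm, A Wm & forall z, D z -> W z = u z ^+ m * Wm z.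
  elim: m => [|m [Wm hWm eW]]; first by exists W => // t _; rewrite mul1r.
  have Wm0 : Wm x0 = 0 by apply: contrapT => ?; apply: hn; exists m, Wm.
  have [H hH eH] := dr_div_point Dx0 hWm; exists H => // t ht.
  by move: (eH t ht); rewrite Wm0 ux0 !subr0 exprSr -mulrA => <-; exact: eW.
have u1 : 0 <= nrm (u z) < 1.
  by rewrite av_ge0 /=; move: (dr_lt1 disc hz Dx0); rewrite ux0 subr0.
have Wpos : 0 < nrm (W z) by rewrite valring_gt0; apply/eqP.
have [n0 /(_ n0 (leqnn _))] := expr_lt_eventually u1 Wpos.
have [Wm _ ->] := hm n0; last by [].
rewrite rmorphM rmorphXn avM avX ltNge => /negP[].
by rewrite ler_piMr ?exprn_ge0 ?av_ge0 ?valring_le1.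
Qed.


Variable psi : T -> T.
Hypotheses (psi_adm : admissible D A psi) (psi_x0 : psi x0 = x0).

(** Divisibility of increments makes admissible maps non-expanding. *)
Lemma dr_norm_orbit i y : D y -> nrm (u (iter i psi y)) <= nrm (u y).
Proof.
move=> hy; have [_ hA] := admissible_iter i psi_adm.
have := dr_lipschitz (hA _ (dr_par disc)) hy Dx0.
by rewrite /= (iter_fix _ psi_x0) ux0 !subr0.
Qed.

(** At the centre, each of the [r] linear factors of [Z] has norm at most
  [|u y|], since the orbit moves no farther away from the centre. *)
Lemma dr_orbit_bound Z y r : A Z -> D y -> exact_period psi y r ->
  (forall i, (i < r)%N -> Z (iter i psi y) = 0) ->
  nrm (Z x0) <= nrm (u y) ^+ r.
Proof.
move=> hZ hy per Z0.
have [|H _ eH] := @dr_factor_zeros r (fun i => iter i psi y) Z hZ _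
  (fun i j => @exact_period_orbit_inj _ _ _ _ i j per).
  by move=> i /Z0; split=> //; apply: (proj1 (admissible_iter i psi_adm)).
rewrite eH // rmorphM rmorph_prod avM av_prod.
apply: le_trans (_ : \prod_(i < r) nrm (u x0 - u (iter i psi y)) <= _).
  by rewrite ler_piMr ?valring_le1 ?prodr_ge0 // => i _; exact: av_ge0.
have -> : nrm (u y) ^+ r = \prod_(i < r) nrm (u y).
  by rewrite prodr_const card_ord.
apply: ler_prod => i _; rewrite av_ge0 ux0 sub0r rmorphN avN.
exact: dr_norm_orbit.
Qed.

Lemma dr_orbit_neq0 y r i : D y -> exact_period psi y r -> y <> x0 ->
  (i <= r)%N -> u (iter i psi y) <> 0.
Proof.
move=> hy [_ hr _] yx ir; rewrite -ux0 => e; apply: yx.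
have Di : D (iter i psi y) by apply: (proj1 (admissible_iter i psi_adm)).
by rewrite -hr -(subnK ir) iterD (dr_inj disc Di Dx0 e) iter_fix.
Qed.

Variable p : nat.
Hypotheses (p_gt1 : (1 < p)%N) (vp0 : 0 < v p%:R) (vp1 : v p%:R < 1)
  (v_coprime : forall e, ~~ (p %| e)%N -> v e%:R = 1).

(** The uniform bound around a fixed point. The three cases of the proof differ
  in the function vanishing on the orbit to which [dr_orbit_bound] is applied;
  the threshold [|p|] for the distance of [lam ^+ r] to [1] is the one that
  makes the quotient of the displacements of orders [r] and [r / p] have norm
  exactly [|p|] at the centre. *)
Lemma dr_fixed_point_bound :
  (forall s, (0 < s)%N -> exists2 z, D z & iter s psi z <> z) ->
  exists2 c : R, 0 < c & forall y r, D y -> y <> x0 -> exact_period psi y r ->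
    c <= nrm (u y) ^+ r.
Proof.
move=> hinf; have [L hL eL] := dr_multiplier psi_adm psi_x0.
pose lam := val (L x0); have lam1 : v lam <= 1 := valring_le1 _.
have hLam j := dr_cocycle psi_adm psi_x0 hL eL j.
(* The generic case: the multiplier of the [r]-th iterate is far from [1]. *)
have far y r : D y -> y <> x0 -> exact_period psi y r ->
    v (lam ^+ r - 1) <= nrm (u y) ^+ r.
  move=> hy yx per; have [P [hP Px eP]] := hLam r.
  have := dr_orbit_bound (dr_sub hP (dr_const disc 1)) hy per.
  rewrite Px rmorphB rmorphXn rmorph1; apply=> i ir.
  have Di : D (iter i psi y) by apply: (proj1 (admissible_iter i psi_adm)).
  apply: (@valring_mulfI _ _ _ (u (iter i psi y))).
    by apply/eqP; exact: dr_orbit_neq0 hy per yx (ltnW ir).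
  rewrite mulr0 mulrBr mulr1 -eP // -iterD addnC iterD.
  by case: per => _ -> _; rewrite subrr.
have [[s0 hs0]|hs0] := pselect (exists s, (0 < s)%N /\ v (lam ^+ s - 1) < v p%:R);
  last first.
  exists (v p%:R) => // y r hy yx per; apply: le_trans (far y r hy yx per).
  by rewrite leNgt; apply/negP => h; apply: hs0; exists r; case: per.
have ex : exists s, (0 < s)%N && (v (lam ^+ s - 1) < v p%:R).
  by exists s0; apply/andP.
case: (ex_minnP ex) => s /andP[sgt0 hs] smin {s0 hs0 ex}.
have vlam : v lam = 1.
  have : v (lam ^+ s) = 1.
    rewrite -[lam ^+ s](subrK 1) addrC avD_strict ?av1 //.
    exact: lt_trans hs vp1.
  by rewrite avX => /eqP; rewrite pexpr_eq1 ?av_ge0 // => /eqP.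
(* The exponents [r] with [lam ^+ r] close to [1] are the multiples of [s]. *)
have near_mul a : v (lam ^+ (a * s) - 1) < v p%:R.
  rewrite mulnC exprM subrX1 avM; apply: le_lt_trans hs.
  rewrite ler_piMr ?av_ge0 //; apply: av_sum_le => // i.
  by rewrite !avX vlam !expr1n.
have near_dvd r : v (lam ^+ r - 1) < v p%:R -> (s %| r)%N.
  move=> hr; rewrite /dvdn; apply: contraTT hr => hmod; rewrite -leNgt.
  have hb : v p%:R <= v (lam ^+ (r %% s) - 1).
    rewrite leNgt; apply/negP => h.
    have := smin (r %% s)%N; rewrite lt0n (negPf hmod) h => /(_ isT).
    by rewrite leqNgt ltn_mod sgt0.
  rewrite leNgt; apply/negP => hr.
  have : v (lam ^+ (r %% s) - 1) < v p%:R.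
    have -> : v (lam ^+ (r %% s) - 1)
        = v (lam ^+ (r %/ s * s) * (lam ^+ (r %% s) - 1)).
      by rewrite avM avX vlam expr1n mul1r.
    have -> : lam ^+ (r %/ s * s) * (lam ^+ (r %% s) - 1)
        = (lam ^+ r - 1) - (lam ^+ (r %/ s * s) - 1).
      by rewrite mulrBr mulr1 -exprD -divn_eq opprB addrA addrNK.
    by apply: le_lt_trans (avB _ _ _) _; rewrite gt_max hr near_mul.
  by rewrite ltNge hb.
have hadm j := admissible_iter j psi_adm.
have hfix j : iter j psi x0 = x0 by exact: iter_fix.
(* The displacement of the [s]-th iterate, cleared of its zero at the
   centre. *)
have [Ms [hMs Msx eMs]] := hLam s.
pose W z := u (iter s psi z) - u z.
have hW : A W by apply: dr_sub (proj2 (hadm s) _ (dr_par disc)) (dr_par disc).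
have [|m [Wm [hWm Wm0 eW]]] := dr_order hW.
  have [z hz hzs] := hinf s sgt0; exists z => // /eqP; rewrite subr_eq0 => /eqP e.
  by apply: hzs; apply: (dr_inj disc _ hz e); exact: (proj1 (hadm s)).
exists (Num.min (v p%:R) (nrm (Wm x0))).
  by rewrite lt_min vp0 valring_gt0; apply/eqP.
move=> y r hy yx per; rewrite ge_min.
have [hr|hr] := leP (v p%:R) (v (lam ^+ r - 1)).
  by rewrite (le_trans hr (far y r hy yx per)).
have [rgt0 hyr _] := per.
have /dvdnP[e def_r] := near_dvd r hr.
have Dorb i : D (iter i psi y) := proj1 (hadm i) y hy.
have hyri i : iter r psi (iter i psi y) = iter i psi y.
  by rewrite -iterD addnC iterD hyr.
have [/dvdnP[e' def_e]|pe] := boolP (p %| e)%N.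
  (* The orbit consists of zeros of the quotient of the displacements of the
     iterates of orders [r] and [r / p]. *)
  pose q := (e' * s)%N; have def_q : r = (p * q)%N.
    by rewrite def_r def_e mulnC mulnCA mulnA mulnC.
  have [M [hM Mx eM]] := hLam q.
  have [Q [hQ Qx eQ]] := dr_displacement p (hadm q) (hfix q) hM eM.
  apply/orP; left.
  have <- : nrm (Q x0) = v p%:R.
    rewrite Qx Mx rmorph_sum -(@av_sum_powers _ _ v (lam ^+ q) p) ?avX ?vlam ?expr1n //.
      by congr (v _); apply: eq_bigr => j _; rewrite !rmorphXn.
    exact: near_mul.
  apply: (dr_orbit_bound hQ hy per) => i ir.
  apply: (@valring_mulfI _ _ _ (u (iter q psi (iter i psi y)) - u (iter i psi y))).
    apply/eqP => /eqP; rewrite subr_eq0 => /eqP /(dr_inj disc _ _) hi.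
    have := exact_period_shift (j := q) per (ltnW ir).
    case: per => _ _ hmin hsh; apply: (hmin q); last first.
      by apply: hsh; apply: hi => //; apply: (proj1 (hadm q)).
    by move: rgt0; rewrite def_q; nia.
  rewrite mulr0 -eQ //.
  have -> : iter p (iter q psi) (iter i psi y) = iter r psi (iter i psi y).
    by rewrite def_q iterM.
  by rewrite hyri subrr.
have [Q [hQ Qx eQ]] := dr_displacement e (hadm s) (hfix s) hMs eMs.
apply/orP; right.
have <- : nrm (Wm x0 * Q x0) = nrm (Wm x0).
  rewrite rmorphM avM Qx Msx rmorph_sum.
  have := @av_sum_powers _ _ v (lam ^+ s) e; rewrite v_coprime //.
  rewrite avX vlam expr1n lexx => /(_ isT (lt_trans hs vp1)) hsum.
  rewrite -[RHS]mulr1 -hsum; congr (_ * v _).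
  by apply: eq_bigr => j _; rewrite !rmorphXn.
apply: (dr_orbit_bound (Z := fun z => Wm z * Q z) _ hy per) => [|i ir].
  exact: (dr_mul disc).
apply: (@valring_mulfI _ _ _ (u (iter i psi y) ^+ m)).
  rewrite -(inj_eq val_inj) rmorphXn /= expf_eq0 negb_and; apply/orP; right.
  apply/eqP => h; apply: (dr_orbit_neq0 hy per yx (ltnW ir)).
  exact: val_inj.
rewrite mulr0 mulrA -eW // /W -eQ //.
have -> : iter e (iter s psi) (iter i psi y) = iter r psi (iter i psi y).
  by rewrite def_r iterM.
by rewrite hyri subrr.
Qed.


(** Transfer from the periodic point [x0] to any other point. By the ultrametric
  inequality only the [y] closer to [x] than [x0] matter. They all lie at the
  same distance from [x0] as [x], so that their periods are bounded by the
  previous lemma; and [psi] being non-expanding, [|u (psi^r x) - u x|] is at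
  most [|u y - u x|] if [r] is the period of [y]. *)
Lemma dr_periodic_bound x : D x ->
  (x = x0 \/ forall r, (0 < r)%N -> iter r psi x <> x) ->
  (forall s, (0 < s)%N -> exists2 z, D z & iter s psi z <> z) ->
  exists2 c : R, 0 < c & forall y r, D y -> y <> x -> exact_period psi y r ->
    c <= nrm (u y - u x) ^+ r.
Proof.
move=> hx xper hinf; have [c0 c0gt0 hc0] := dr_fixed_point_bound hinf.
have [->|xx0] := pselect (x = x0).
  exists c0 => // y r hy yx per; rewrite ux0 subr0; exact: hc0.
case: xper => // xper.
have ux : u x <> 0 by rewrite -ux0 => /(dr_inj disc hx Dx0).
have rho0 : 0 < nrm (u x) by rewrite valring_gt0; apply/eqP.
have rho1 : 0 <= nrm (u x) < 1.
  by rewrite ltW //=; have := dr_lt1 disc hx Dx0; rewrite ux0 subr0.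
have [n0 hn0] := expr_lt_eventually rho1 c0gt0.
pose f r : R := if r is 0 then 1 else nrm (u (iter r psi x) - u x) ^+ r.
have [[//|r] _|c1 c1gt0 hc1] := finite_positive_lower_bound (f := f) (finite_II n0).
  rewrite exprn_gt0 // valring_gt0 subr_eq0; apply/eqP => /(dr_inj disc _ hx) e.
  by apply: (xper r.+1) => //; apply: e; apply: (proj1 (admissible_iter _ psi_adm)).
exists (Num.min (nrm (u x)) (Num.min c0 c1)); first by rewrite !lt_min rho0 c0gt0.
move=> y r hy yx per; have [rgt0 hyr hmin] := per; rewrite !ge_min.
have [rho_le|rho_lt] := leP (nrm (u x)) (nrm (u y - u x)).
  have [yx0|yx0] := pselect (y = x0).
    have r1 : r = 1%N.
      apply/eqP; rewrite eqn_leq rgt0 andbT leqNgt; apply/negP => r1.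
      by apply: (hmin 1%N) => //=; rewrite yx0.
    by rewrite r1 expr1 rho_le.
  apply/orP; right; apply/orP; left; apply: le_trans (hc0 y r hy yx0 per) _.
  apply: lerXn2r; rewrite ?nnegrE ?av_ge0 //.
  rewrite -[X in nrm X](subrK (u x)) rmorphD.
  by apply: le_trans (av_ultra _ _ _) _; rewrite ge_max lexx.
have uy : nrm (u y) = nrm (u x).
  by rewrite -[X in nrm X](subrK (u x)) rmorphD addrC avD_strict.
have yx0 : y <> x0.
  by move=> e; move: rho0; rewrite -uy e ux0 raddf0 av0 ltxx.
have rn0 : (r < n0)%N.
  rewrite ltnNge; apply/negP => /hn0; rewrite -uy ltNge.
  by rewrite hc0.
apply/orP; right; apply/orP; right; apply: le_trans (hc1 r rn0) _.
rewrite /f; case: r rgt0 hyr {per hmin rn0} => // r _ hyr.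
apply: lerXn2r; rewrite ?nnegrE ?av_ge0 //.
have hA : A (fun z => u (iter r.+1 psi z) - u z).
  exact: (dr_sub (proj2 (admissible_iter r.+1 psi_adm) _ (dr_par disc)) (dr_par disc)).
have := dr_lipschitz hA hx hy.
by rewrite hyr subrr subr0 rmorphB [in X in _ <= X]av_distC -rmorphB.
Qed.

End Disc.

(** * Hilbert's basis theorem *)

Lemma nondecreasing_subsequence (a : nat -> nat) :
  exists2 s : nat -> nat, {homo s : i j / (i < j)%N} &
    {homo a \o s : i j / (i <= j)%N}.
Proof.
have hmin (i : nat) : exists t, (i < t)%N /\ forall j, (i < j)%N -> (a t <= a j)%N.
  have ex : exists m, `[< exists2 t, (i < t)%N & a t = m >].
    by exists (a i.+1); apply/asboolP; exists i.+1.
  case: (ex_minnP ex) => m /asboolP[t it <-] h; exists t; split=> // j ij.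
  by apply: h; apply/asboolP; exists j.
have [t ht] := choice hmin.
exists (fun j => iter j.+1 t 0%N).
  by apply: homo_ltn => [x y z|i] //; [exact: ltn_trans|exact: (ht _).1].
apply: homo_leq => [//|x y z|i]; first exact: leq_trans.
by apply: (ht _).2; rewrite /=; apply: ltn_trans (ht _).1; exact: (ht _).1.
Qed.

(** Dickson's lemma: monotone subsequences are extracted one exponent at a
  time. *)
Lemma multinom_good_pair n (m : nat -> 'X_{1..n}) :
  exists i j, (i < j)%N /\ (m i <= m j)%MM.
Proof.
have sub k : exists2 s : nat -> nat, {homo s : i j / (i < j)%N} &
    forall l : 'I_n, (l < k)%N -> forall i j, (i <= j)%N -> (m (s i) l <= m (s j) l)%N.
  elim: k => [|k [s hs hk]]; first by exists id.
  have [kn|nk] := ltnP k n; last first.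
    by exists s => // l _; apply: hk; exact: leq_trans (ltn_ord l) nk.
  have [t ht hat] := nondecreasing_subsequence (fun i => m (s i) (Ordinal kn)).
  exists (s \o t) => [i j ij|l lk i j ij]; first exact/hs/ht.
  move: lk; rewrite ltnS leq_eqVlt => /orP[/eqP lk|lk].
    by have -> : l = Ordinal kn; [exact: val_inj|exact: hat].
  apply: hk => //; move: ij; rewrite leq_eqVlt => /orP[/eqP->//|/ht].
  exact: ltnW.
have [s hs hn] := sub n.
exists (s 0%N), (s 1%N); split; first exact: hs.
by apply/mnm_lepP => l; apply: hn.
Qed.

Section Ideals.
Variables (A : comNzRingType).

Inductive ideal_gen (S : A -> Prop) : A -> Prop :=
| Ideal_gen0 : ideal_gen S 0
| Ideal_gen_in a : S a -> ideal_gen S a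
| Ideal_genD a b : ideal_gen S a -> ideal_gen S b -> ideal_gen S (a + b)
| Ideal_genM a b : ideal_gen S b -> ideal_gen S (a * b).

Lemma ideal_gen_trans (S S' : A -> Prop) a :
  (forall b, S b -> ideal_gen S' b) -> ideal_gen S a -> ideal_gen S' a.
Proof.
move=> hS; elim=> [|b /hS//|b c _ hb _ hc|b c _ hc].
- exact: Ideal_gen0.
- exact: Ideal_genD.
- exact: Ideal_genM.
Qed.

Lemma ideal_gen_sub (S S' : A -> Prop) a :
  (forall b, S b -> S' b) -> ideal_gen S a -> ideal_gen S' a.
Proof. by move=> hS; apply: ideal_gen_trans => b /hS; exact: Ideal_gen_in. Qed.

End Ideals.

Lemma mlead_reduce (F : fieldType) n (a b : {mpoly F[n]}) :
  a != 0 -> b != 0 -> (mlead a <= mlead b)%MM ->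
  exists c, b - c * a = 0 \/ (mlead (b - c * a) < mlead b)%O.
Proof.
move=> a0 b0 hab.
pose c : {mpoly F[n]} := (b@_(mlead b) / a@_(mlead a)) *: 'X_[mlead b - mlead a].
have la0 : a@_(mlead a) != 0 by rewrite mleadc_eq0.
have lb0 : b@_(mlead b) != 0 by rewrite mleadc_eq0.
have q0 : b@_(mlead b) / a@_(mlead a) != 0 by rewrite mulf_neq0 ?invr_eq0.
have c0 : c != 0.
  by apply: contraNneq q0 => /(congr1 (mcoeff (mlead b - mlead a)));
     rewrite mcoeffZ mcoeffX eqxx mulr1 mcoeff0 => ->.
have mc : mlead c = (mlead b - mlead a)%MM by rewrite /c mleadZ // mleadXm.
have lc : mlead (c * a) = mlead b by rewrite mleadM // mc submK.
have cc : (c * a)@_(mlead b) = b@_(mlead b).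
  rewrite -{1}lc mleadM // mleadcM mc /c mcoeffZ mcoeffX eqxx mulr1.
  by rewrite divfK.
exists c; have [->|d0] := eqVneq (b - c * a) 0; [by left|right].
rewrite lt_neqAle; apply/andP; split.
  apply: contraNneq d0 => e; rewrite -mleadc_eq0 e mcoeffB cc subrr eqxx //.
by apply: le_trans (mleadB_le _ _) _; rewrite lc joinxx.
Qed.

(** Hilbert's basis theorem. Otherwise the ideal of the sequence is not finitely
  generated, and choosing in it, again and again, an element of minimal leading
  monomial outside the ideal of those already chosen produces leading monomials
  none of which divides a later one, against Dickson's lemma. *)
Theorem mpoly_noetherian (F : fieldType) n (g : nat -> {mpoly F[n]}) :
  exists j, ideal_gen (fun h => exists2 i, (i < j)%N & h = g i) (g j).
Proof.
apply: contrapT => /forallNP hn.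
pose G j h := exists2 i, (i < j)%N & h = g i.
pose I h := exists j, ideal_gen (G j) h.
have Gmono i j h : (i <= j)%N -> ideal_gen (G i) h -> ideal_gen (G j) h.
  by move=> ij; apply: ideal_gen_sub => b [l li ->]; exists l => //; exact: leq_trans ij.
have next (s : seq {mpoly F[n]}) : exists h, (forall a, a \in s -> I a) ->
    [/\ I h, ~ ideal_gen (fun a => a \in s) h & forall h', I h' ->
       ~ ideal_gen (fun a => a \in s) h' -> ~ (mlead h' < mlead h)%O].
  have [hs|hs] := pselect (forall a, a \in s -> I a); last by exists 0.
  have [J hJ] : exists J, forall a, a \in s -> ideal_gen (G J) a.
    elim: s hs => [|a s IHs] hs; first by exists 0%N.
    have [J1 h1] := IHs (fun b hb => hs b (mem_behead (s := a :: s) hb)).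
    have [J2 h2] := hs a (mem_head _ _).
    exists (maxn J1 J2) => b; rewrite inE => /orP[/eqP->|/h1].
      exact: Gmono (leq_maxr _ _) h2.
    exact: Gmono (leq_maxl _ _).
  have h0 : I (g J) /\ ~ ideal_gen (fun a => a \in s) (g J).
    split; first by exists J.+1; apply: Ideal_gen_in; exists J.
    by move=> h; apply: (hn J); apply: ideal_gen_trans h.
  have wf := @ltom_wf n.
  have [m] : exists m, m = mlead (g J) by exists (mlead (g J)).
  elim/(well_founded_ind wf): m (g J) h0 => m IHm h [Ih sh] em.
  have [[h' [Ih' sh' lt']]|hmin] := pselect (exists h', [/\ I h',
     ~ ideal_gen (fun a => a \in s) h' & (mlead h' < mlead h)%O]).
    by apply: (IHm (mlead h')) (erefl _) => //; rewrite em.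
  exists h => _; split=> // h' Ih' sh' lt'.
  by apply: hmin; exists h'.
have [pk hpk] := choice next.
pose st j := iter j (fun s => rcons s (pk s)) [::].
have stI j : forall a, a \in st j -> I a.
  elim: j => [//|j IHj] a; rewrite /st /= mem_rcons inE => /orP[/eqP->|/IHj//].
  by have [] := hpk _ IHj.
have stm i j : (i < j)%N -> pk (st i) \in st j.
  elim: j => [//|j IHj]; rewrite ltnS leq_eqVlt /st /= mem_rcons inE.
  by move=> /orP[/eqP->|/IHj h]; rewrite ?eqxx // h orbT.
have pk0 j : pk (st j) != 0.
  by apply/eqP => e; have [_ + _] := hpk _ (@stI j); rewrite e; case; exact: Ideal_gen0.
have [i [j [ij lij]]] := multinom_good_pair (fun j => mlead (pk (st j))).
have [[J hJ] hj hmin] := hpk _ (@stI j).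
have [c hc] := mlead_reduce (pk0 i) (pk0 j) lij.
have ispan : ideal_gen (fun a => a \in st j) (c * pk (st i)).
  by apply/Ideal_genM/Ideal_gen_in/stm.
have dspan : ~ ideal_gen (fun a => a \in st j) (pk (st j) - c * pk (st i)).
  by move=> h; apply: hj; rewrite -[pk (st j)](subrK (c * pk (st i))); exact: Ideal_genD.
case: hc => [d0|]; first by apply: dspan; rewrite d0; exact: Ideal_gen0.
apply: hmin => //; have [J' hJ'] := stI j _ (stm _ _ ij).
exists (maxn J J'); apply: Ideal_genD; first exact: Gmono (leq_maxl _ _) hJ.
rewrite -mulNr; apply: Ideal_genM; exact: Gmono (leq_maxr _ _) hJ'.
Qed.

(** * Closed subsets of a projective curve *)

Section ProjectivePoints.
Variables (F : fieldType) (N : nat).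
Implicit Types (x y : proj F N) (X Y : 'rV[F]_N.+1).

Lemma hcoords_vline x X : hcoords x X -> val x = <[X]>%VS.
Proof.
case: x => L hL [/= XL X0]; apply/esym/eqP.
by rewrite eqEdim -memvE XL dim_vline X0 (eqP hL).
Qed.

Lemma hcoords_inj x y X : hcoords x X -> hcoords y X -> x = y.
Proof. by move=> /hcoords_vline hx /hcoords_vline hy; apply: val_inj; rewrite hx hy. Qed.

Lemma hcoords_neq0 x X : hcoords x X -> exists i, X ord0 i != 0.
Proof.
move=> [_ X0]; apply/existsP; apply: contraNT X0 => /existsPn h.
by apply/eqP/rowP => i; rewrite mxE; apply/eqP; have := h i; rewrite negbK.
Qed.

Lemma proj_eq x y X Y : hcoords x X -> hcoords y Y ->
  (forall i j, X ord0 i * Y ord0 j = X ord0 j * Y ord0 i) -> x = y.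
Proof.
move=> hx hy e; have [l Yl] := hcoords_neq0 hy.
have eX : X = (X ord0 l / Y ord0 l) *: Y.
  by apply/rowP => i; rewrite mxE mulrAC e mulfK.
apply: (hcoords_inj hx); split; last by case: hx.
by rewrite eX memvZ //; case: hy.
Qed.

End ProjectivePoints.

Section Curves.
Variables (K : closedFieldType) (N : nat).
Implicit Types (x y : proj K N) (Z W : set (proj K N)).

Lemma algebraic_set_capP Z W :
  algebraic_set Z -> algebraic_set W -> algebraic_set (Z `&` W).
Proof.
move=> [S [hS ->]] [S' [hS' ->]]; exists (S `|` S'); split.
  by move=> f [/hS|/hS'].
rewrite eqEsubset; split=> x /= => [[h h'] f [/h|/h']//|h].
by split=> f Sf; apply: h; [left|right].
Qed.

(** A minimal infinite closed subset, which exists by noetherianity, is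
  irreducible: of two closed sets covering it one has an infinite trace. *)
Lemma infinite_algebraic_irreducible Z : algebraic_set Z -> infinite_set Z ->
  exists W, [/\ irreducible_set W, W `<=` Z & infinite_set W].
Proof.
move=> aZ iZ.
have [W [aW iW WZ Wmin]] : exists W, [/\ algebraic_set W, infinite_set W, W `<=` Z &
    forall W', algebraic_set W' -> infinite_set W' -> W' `<=` W -> W `<=` W'].
  apply: contrapT => hn.
  have next W : exists W', algebraic_set W /\ infinite_set W /\ W `<=` Z ->
      [/\ algebraic_set W', infinite_set W', W' `<=` W & ~ W `<=` W'].
    have [[aW [iW WZ]]|h] := pselect (algebraic_set W /\ infinite_set W /\ W `<=` Z); last by exists W.
    apply: contrapT => hW; apply: hn; exists W; split=> // W' aW' iW' W'W.
    by apply: contrapT => h; apply: hW; exists W'.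
  have [nx hnx] := choice next.
  pose st i := iter i nx Z.
  have hst i : [/\ algebraic_set (st i), infinite_set (st i) & st i `<=` Z].
    elim: i => [|i [h1 h2 h3]]; first by split.
    have [|h1' h2' h3' _] := hnx (st i) _; first by split.
    by split=> //; apply: subset_trans h3.
  have step i : st i.+1 `<=` st i /\ ~ st i `<=` st i.+1.
    by have [h1 h2 h3] := hst i; have [|h1' h2' h3' ?] := hnx (st i) _.
  have mono i j : (i <= j)%N -> st j `<=` st i.
    elim: j => [|j IHj]; first by rewrite leqn0 => /eqP->.
    rewrite leq_eqVlt => /orP[/eqP->//|/IHj].
    by apply: subset_trans; exact: (step j).1.
  have hg i : exists g, (forall x, st i.+1 x -> vanishes_at g x) /\
      exists2 x, st i x & ~ vanishes_at g x.
    have [[S [_ eS]] _ _] := hst i.+1; have [_] := step i.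
    apply: contra_notP => /forallNP h x hx; rewrite eS /= => f Sf.
    apply: contrapT => hf; apply: (h f); split; last by exists x.
    by move=> y; rewrite eS; apply.
  have [g hgg] := choice hg.
  have [j hj] := mpoly_noetherian g.
  have [_ [x hx]] := hgg j; apply.
  elim: hj => [X _|a [i ij ->]|a b _ ha _ hb X hX|a b _ hb X hX].
  - by rewrite meval0.
  - by apply: (hgg i).1; exact: mono ij _ hx.
  - by rewrite mevalD ha // hb // addr0.
  - by rewrite mevalM hb // mulr0.
exists W; split=> //; split=> //.
  by apply/set0P; apply/eqP => e; case: iW; rewrite e; exact: finite_set0.
move=> A B aA aB WAB.
have [fA|iA] := pselect (finite_set (W `&` A)).
  right; have iB : infinite_set (W `&` B).
    move=> fB; apply: iW; apply: (@sub_finite_set _ _ ((W `&` A) `|` (W `&` B))).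
      by move=> x hx; have [?|?] := WAB x hx; [left|right].
    by rewrite finite_setU.
  have := Wmin _ (algebraic_set_capP aW aB) iB (@subIsetl _ _ _).
  by move=> h x /h[].
left; have := Wmin _ (algebraic_set_capP aW aA) iA (@subIsetl _ _ _).
by move=> h x /h[].
Qed.

Lemma irreducible_point y : irreducible_set [set y].
Proof.
have [Y hY] := hcoords_ex y.
split; last 1 first.
- by move=> A B _ _ /(_ y erefl)[h|h]; [left|right] => x ->.
- pose q (ij : 'I_N.+1 * 'I_N.+1) : {mpoly K[N.+1]} :=
    Y ord0 ij.1 *: 'X_ij.2 - Y ord0 ij.2 *: 'X_ij.1.
  have evq ij X : (q ij).@[X ord0]
      = Y ord0 ij.1 * X ord0 ij.2 - Y ord0 ij.2 * X ord0 ij.1.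
    by rewrite mevalB !mevalZ !mevalXU.
  exists (range q); split.
    move=> _ [ij _ <-]; exists 1%N.
    by apply: rpredB; apply: rpredZ; rewrite dhomogX; apply/eqP; exact: mdeg1.
  rewrite eqEsubset; split=> [_ -> _ [ij _ <-] X hX|x h /=].
    have [t _ ->] := hcoordsE hY hX.
    by rewrite evq !mxE; ring.
  have [X hX] := hcoords_ex x.
  apply/esym; apply: (proj_eq hY hX) => i j.
  have := h (q (i, j)) (ex_intro2 _ _ (i, j) I erefl) X hX.
  by rewrite evq => /eqP; rewrite subr_eq0 => /eqP.
- by exists y.
Qed.

Variable C : curve K N.

(** One-dimensionality: an infinite zero set would contain an irreducible
  closed set strictly between one of its points and the curve. *)
Lemma curve_zeros_finite g : g \notin vanishing_ideal C ->
  finite_set [set x | C x /\ vanishes_at g x].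
Proof.
move=> gC; apply: contrapT => hinf; have [aC _ _] := curve_irr C.
have [W [irrW WZ iW]] := infinite_algebraic_irreducible (algebraic_setI g aC) hinf.
have [_ [y Wy] _] := irrW.
have [_] := curve_dim C; apply.
exists (fun i => match i with 0 => [set y] | 1 => W | _ => curve_pts C end).
split=> [[|[|[|//]]] _|[|[|//]] _].
- split; first exact: irreducible_point.
  by move=> _ ->; case: (WZ y Wy).
- by split=> // x /WZ[].
- by split=> //; exact: curve_irr.
- split=> [_ ->//|h]; apply: iW; exact: sub_finite_set h (finite_set1 y).
- split=> [x /WZ[]//|h]; move/negP: gC; apply.
  by apply/videalP => x /h/WZ[].
Qed.

End Curves.

(** * Morphisms with an iterate fixing infinitely many points *)

Section FunctionFieldElements.
Variables (K : closedFieldType) (N : nat) (C : curve K N).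
Implicit Types (a b f g : {mpoly K[N.+1]}).

Lemma coord_classE a b :
  (coord_class C a == coord_class C b) = (a - b \in vanishing_ideal C).
Proof. by rewrite /coord_class eqmodE /= Quotient.equivE. Qed.

Lemma class_frac_eq a b a' b' :
  b \notin vanishing_ideal C -> b' \notin vanishing_ideal C ->
  a * b' - a' * b \in vanishing_ideal C ->
  class_frac C a b = class_frac C a' b'.
Proof.
move=> hb hb' h.
have nz c : c \notin vanishing_ideal C -> tofrac (coord_class C c) != 0.
  move=> hc; rewrite tofrac_eq0.
  have -> : (0 : coord_ring C) = coord_class C 0 by rewrite /coord_class rmorph0.
  by rewrite coord_classE subr0.
apply/eqP; rewrite /class_frac eqr_div ?nz // -!tofracM tofrac_eq.
by rewrite /coord_class -!rmorphM -!/(coord_class C _) coord_classE.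
Qed.

Lemma videal_infinite f (Z : set (proj K N)) : infinite_set Z ->
  (forall x, Z x -> C x /\ vanishes_at f x) -> f \in vanishing_ideal C.
Proof.
move=> iZ hZ; apply: contrapT => /negP /curve_zeros_finite; apply: contra_not iZ.
exact: sub_finite_set.
Qed.

End FunctionFieldElements.

Lemma meval_homogZ (K : closedFieldType) (N : nat) (f : {mpoly K[N.+1]}) e t
    (X : 'rV[K]_N.+1) :
  f \is e.-homog -> f.@[(t *: X) ord0] = t ^+ e * f.@[X ord0].
Proof.
by move=> hf; rewrite -horner_on_line (on_line_homog _ hf) hornerZ hornerXn mulrC.
Qed.

Section FiniteOrder.
Variables (K : closedFieldType) (N : nat) (C : curve K N) (phi : self_morphism C).
Implicit Types (a b : {mpoly K[N.+1]}) (X Y : 'rV[K]_N.+1) (x y z : proj K N).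

Local Notation I := (vanishing_ideal C).
Local Notation F := (mor_forms phi).

Definition eval_forms (G : {ffun 'I_N.+1 -> {mpoly K[N.+1]}}) X : 'rV[K]_N.+1 :=
  \row_i (G i).@[X ord0].

(** Dividing by the nonzero form [F l] is possible because the ideal of the
  curve is prime. *)
Lemma represents_value G H z X : represents C F G -> represents C F H -> C z ->
  hcoords z X -> forall i j, (G i).@[X ord0] * (H j).@[X ord0]
    = (G j).@[X ord0] * (H i).@[X ord0].
Proof.
move=> [_ hG] [_ hH] Cz hX i j; have [l Fl] := mor_notin phi.
suff /videalP/(_ z Cz X hX) : G i * H j - G j * H i \in I.
  by rewrite mevalB !mevalM => /eqP; rewrite subr_eq0 => /eqP.
suff : F l * (F l * (G i * H j - G j * H i)) \in I.
  by move=> /(@videal_prime _ _ C)/orP[|/(@videal_prime _ _ C)/orP[]//];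
     rewrite (negbTE Fl).
apply/videalP => x Cx Y hY; rewrite !mevalM mevalB !mevalM.
have ev P Q a b : P * Q - a * b \in I ->
    P.@[Y ord0] * Q.@[Y ord0] = a.@[Y ord0] * b.@[Y ord0].
  by move=> /videalP/(_ x Cx Y hY); rewrite mevalB !mevalM => /eqP;
     rewrite subr_eq0 => /eqP.
have e1 := ev _ _ _ _ (hG l i); have e2 := ev _ _ _ _ (hH l j).
have e3 := ev _ _ _ _ (hG l j); have e4 := ev _ _ _ _ (hH l i).
rewrite mulrBr mulrBr.
have -> : (F l).@[Y ord0] * ((F l).@[Y ord0] * ((G i).@[Y ord0] * (H j).@[Y ord0]))
  = ((F l).@[Y ord0] * (G i).@[Y ord0]) * ((F l).@[Y ord0] * (H j).@[Y ord0]) by ring.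
have -> : (F l).@[Y ord0] * ((F l).@[Y ord0] * ((G j).@[Y ord0] * (H i).@[Y ord0]))
  = ((F l).@[Y ord0] * (G j).@[Y ord0]) * ((F l).@[Y ord0] * (H i).@[Y ord0]) by ring.
by rewrite e1 e2 e3 e4; ring.
Qed.

Lemma represents_refl : represents C F F.
Proof.
split; first exact: mor_homog.
by move=> i j; rewrite [F j * F i]mulrC subrr; apply/videalP => x _ X _; rewrite meval0.
Qed.

(** Representations being proportional at each point, any of them that does not
  vanish there can replace the one that defines the value of the morphism. *)
Lemma represents_hcoords G z X : represents C F G -> C z -> hcoords z X ->
  eval_forms G X != 0 -> hcoords (phi z) (eval_forms G X).
Proof.
move=> hG Cz hX GX0; have [H hH hphi] := mor_repr phi Cz.
have hY := hphi X hX; split=> //; have [l Hl] := hcoords_neq0 hY.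
rewrite mxE in Hl.
have -> : eval_forms G X = ((G l).@[X ord0] / (H l).@[X ord0]) *: eval_forms H X.
  apply/rowP => i; rewrite !mxE mulrAC -(represents_value hG hH Cz hX) mulfK //.
by rewrite memvZ //; case: hY.
Qed.

Lemma meval_subst_forms a X :
  (subst_forms F a).@[X ord0] = a.@[(eval_forms F X) ord0].
Proof.
rewrite /subst_forms comp_mpoly_meval; apply: meval_eq => i.
by rewrite tnth_mktuple mxE.
Qed.

Lemma subst_forms_homog e0 e a : (forall i, F i \is e0.-homog) ->
  a \is e.-homog -> subst_forms F a \is (e0 * e)%N.-homog.
Proof.
move=> hF /dhomogP ha; rewrite /subst_forms comp_mpolyEX big_seq.
apply: rpred_sum => m hm; apply: rpredZ; rewrite comp_mpolyX.
have <- : mdeg m = e := ha m hm; rewrite mdegE big_distrr /=.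
elim/big_ind2: _ => [|P d1 Q d2 hP hQ|i _]; first exact: dhomog1.
  exact: dhomogM.
by rewrite tnth_mktuple; exact: dhomogMn.
Qed.

Lemma meval_iter_subst m a X :
  (iter m (subst_forms F) a).@[X ord0] = a.@[(iter m (eval_forms F) X) ord0].
Proof. by elim: m X => // m IHm X; rewrite iterS meval_subst_forms IHm -iterSr. Qed.

Variable M : nat.
Hypotheses (M_gt0 : (0 < M)%N)
  (infM : infinite_set [set z | C z /\ iter M phi z = z]).

(* Points whose orbit avoids the base points of the forms defining the
   morphism; there the substitution of these forms really computes the
   iterate, which is the identity. *)
Let good : set (proj K N) := [set z | [/\ C z, iter M phi z = z &
  forall X, hcoords z X -> exists2 t, t != 0 & iter M (eval_forms F) X = t *: X]].

Lemma iter_stable j z : C z -> C (iter j phi z).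
Proof. by move=> Cz; elim: j => //= j; exact: mor_stable. Qed.

(* The excluded points have one of their first [M] iterates among the finitely
   many zeros of a form [F l]; applying the remaining iterates shows that they
   are finitely many themselves. *)
Let good_infinite : infinite_set good.
Proof.
have [l Fl] := mor_notin phi.
pose B := [set z | C z /\ vanishes_at (F l) z].
have finB : finite_set B := curve_zeros_finite Fl.
pose P := \bigcup_(j in `I_M) (iter (M - j) phi @` B).
have finP : finite_set P.
  by apply: bigcup_finite => [|j _]; [exact: finite_II|exact: finite_image].
move=> fgood; apply: infM; apply: (@sub_finite_set _ _ (good `|` P)).
  move=> z [Cz hz]; have [hP|hP] := pselect (P z); [by right|left; split=> // X hX].
  have hiter j : (j <= M)%N -> hcoords (iter j phi z) (iter j (eval_forms F) X).
    elim: j => [//|j IHj] jM; have hj := IHj (ltnW jM).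
    apply: (represents_hcoords represents_refl _ hj); first exact: iter_stable.
    apply/eqP => e; apply: hP; exists j => //; exists (iter j phi z).
      split; first exact: iter_stable.
      move=> Y hY; have [t _ ->] := hcoordsE hj hY.
      have [e0 hF] := mor_homog phi; rewrite (meval_homogZ _ _ (hF l)).
      by move/rowP: e => /(_ l); rewrite !mxE => ->; rewrite mulr0.
    by rewrite -iterD subnK // ltnW.
  have := hiter M (leqnn M); rewrite hz => hM.
  exact: hcoordsE hX hM.
by rewrite finite_setU.
Qed.

(** A fraction is the pullback of its pullback by the iterate of order [M - 1],
  since at the good points the forms of order [M] are proportional to the
  coordinates. *)
Lemma function_field_pullback h : function_field C h -> pullback_field phi h.
Proof.
move=> [e [a [b [ha hb bI ->]]]]; have [e0 hF] := mor_homog phi.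
pose sub m c := iter m (subst_forms F) c.
have homM m c : c \is e.-homog -> sub m c \is (iter m (muln e0) e).-homog.
  by move=> hc; elim: m => // m IHm; exact: subst_forms_homog.
have subM c : sub M c = subst_forms F (sub M.-1 c) by rewrite /sub -iterS prednK.
have ev c X t : c \is e.-homog -> iter M (eval_forms F) X = t *: X ->
    (sub M c).@[X ord0] = t ^+ e * c.@[X ord0].
  by move=> hc et; rewrite meval_iter_subst et (meval_homogZ _ _ hc).
have bMI : sub M b \notin I.
  apply: contra bI => /videalP h0; apply: (videal_infinite good_infinite) => z gz.
  have [Cz _ hgz] := gz; split=> // X hX; have [t t0 et] := hgz X hX.
  move: (h0 z Cz X hX); rewrite (ev _ _ _ hb et) => /eqP.
  by rewrite mulf_eq0 expf_eq0 (negbTE t0) andbF => /eqP.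
have bM1I : sub M.-1 b \notin I.
  apply: contra bMI => /videalP h0; apply: (videal_infinite good_infinite) => z gz.
  have [Cz _ _] := gz; split=> // X hX.
  have [F0|F0] := eqVneq (eval_forms F X) 0.
    rewrite subM meval_subst_forms F0.
    have [Y hY] := hcoords_ex z; move: (h0 z Cz Y hY).
    have -> : (0 : 'rV[K]_N.+1) ord0 = (0 *: Y) ord0 by rewrite scale0r.
    by rewrite (meval_homogZ _ _ (homM _ _ hb)) => ->; rewrite mulr0.
  rewrite subM meval_subst_forms; apply: (h0 (phi z)); first exact: mor_stable.
  exact: represents_hcoords represents_refl Cz hX F0.
exists (iter M.-1 (muln e0) e), (sub M.-1 a), (sub M.-1 b).
rewrite -!subM; split; [exact: homM|exact: homM| by []|by []|].
apply: class_frac_eq => //; apply: (videal_infinite good_infinite) => z gz.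
have [Cz _ hgz] := gz; split=> // X hX; have [t _ et] := hgz X hX.
by rewrite mevalB !mevalM (ev _ _ _ ha et) (ev _ _ _ hb et); ring.
Qed.

(** The function field being its own pullback, two elements of a basis would be
  linearly dependent over it. *)
Lemma finite_order_degree_le1 d : mor_degree phi d -> (d <= 1)%N.
Proof.
case=> b Lb uniq_b; rewrite leqNgt; apply/negP => d1.
have L0 : function_field C 0.
  exists 0%N, 0, 1; rewrite dhomog0 dhomog1 /class_frac /coord_class.
  split=> //; last by rewrite rmorph0 tofrac0 mul0r.
  by rewrite idealr1.
have L1 : function_field C 1.
  exists 0%N, 1, 1; rewrite dhomog1 /class_frac /coord_class.
  by split=> //; [rewrite idealr1|rewrite rmorph1 tofrac1 divr1].
have LN h : function_field C h -> function_field C (- h).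
  move=> [e [a [c [ha hc cI ->]]]]; exists e, (- a), c; rewrite rpredN; split=> //.
  by rewrite /class_frac /coord_class rmorphN tofracN mulNr.
have [c [_ cuniq]] := uniq_b 0 L0.
have c0 (g : {ffun 'I_d -> {fraction (coord_ring C)}}) :
    (forall i, function_field C (g i)) -> \sum_i g i * b i = 0 -> g = 0.
  move=> hg eg; rewrite -(cuniq g); last by split=> // i; exact: function_field_pullback.
  apply: cuniq; split; first by move=> i; rewrite ffunE; exact: function_field_pullback.
  by rewrite big1 // => i _; rewrite ffunE mul0r.
pose i0 := Ordinal (ltnW d1); pose i1 := Ordinal d1.
have b0 : b i0 = 0.
  pose g := [ffun i => if i == i0 then b i1 else if i == i1 then - b i0 else 0].
  have /ffunP/(_ i1) : g = 0.
    apply: c0 => [i|]; first by rewrite ffunE; do 2?case: ifP => _ //; exact: LN.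
    rewrite (bigD1 i0) //= (bigD1 i1) //= !ffunE eqxx /= big1 => [|i /andP[h1 h2]].
      by rewrite addr0 mulNr mulrC subrr.
    by rewrite ffunE (negbTE h1) (negbTE h2) mul0r.
  by rewrite !ffunE /= => /eqP; rewrite oppr_eq0 => /eqP.
pose g : {ffun 'I_d -> {fraction (coord_ring C)}} := [ffun i => (i == i0)%:R].
have /ffunP/(_ i0) : g = 0.
  apply: c0 => [i|]; first by rewrite ffunE; case: (i == i0).
  by rewrite (bigD1 i0) //= b0 mulr0 add0r big1 // => i h; rewrite ffunE (negbTE h) mul0r.
by rewrite !ffunE eqxx => /eqP; rewrite oner_eq0.
Qed.

End FiniteOrder.

(** * Polynomial functions and normalized coordinates *)

Section PolynomialFunctions.

Lemma mpoly_alg_ind (A : nzRingType) n (P : {mpoly A[n]} -> Prop) :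
  (forall c, P c%:MP) -> (forall i, P 'X_i) ->
  (forall a b, P a -> P b -> P (a + b)) ->
  (forall a b, P a -> P b -> P (a * b)) -> forall a, P a.
Proof.
move=> hC hX hD hM a; rewrite [a]mpolyE; elim/big_ind: _ => // [|m _].
  by rewrite -mpolyC0.
rewrite -mul_mpolyC; apply: (hM) => //; rewrite mpolyXE_id.
elim/big_ind: _ => [|b c|i _]; [by rewrite -mpolyC1|exact: hM|].
elim: (m i) => [|e IHe]; first by rewrite expr0 -mpolyC1.
by rewrite exprS; exact: hM.
Qed.

Lemma meval_map (A B : comNzRingType) (h : {rmorphism A -> B}) n
    (g : {mpoly A[n]}) (b : 'I_n -> A) :
  (map_mpoly h g).@[fun i => h (b i)] = h g.@[b].
Proof.
elim/mpoly_alg_ind: g => [c|i|g g' hg hg'|g g' hg hg'].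
- by rewrite map_mpolyC ?rmorph0 // !mevalC.
- by rewrite map_mpolyX !mevalXU.
- by rewrite rmorphD /= !mevalD rmorphD hg hg'.
- by rewrite rmorphM /= !mevalM rmorphM hg hg'.
Qed.

Lemma meval_dehom (A : comNzRingType) N (j0 : 'I_N.+1) (g : {mpoly A[N.+1]})
    (b : 'I_N.+1 -> A) : b j0 = 1 ->
  (dehom j0 g).@[fun l => b (lift j0 l)] = g.@[b].
Proof.
move=> bj0; rewrite /dehom comp_mpoly_meval; apply: meval_eq => i.
by rewrite tnth_mktuple; case: unliftP => [j ->|->]; rewrite ?mevalXU // meval1 bj0.
Qed.

End PolynomialFunctions.

Section UnitCoordinates.
Variables (R : realType) (K : fieldType) (v : absval R K) (N : nat).
Local Notation O := (valring v).
Implicit Types (x y : proj K N) (X Y : 'rV[K]_N.+1).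

Lemma bigmax_norm_attained X : exists i,
  \big[Num.max/0]_i v (X ord0 i) = v (X ord0 i) /\ forall j, v (X ord0 j) <= v (X ord0 i).
Proof.
have [i _ hi] : exists2 i : 'I_N.+1, true & forall j, v (X ord0 j) <= v (X ord0 i).
  by case: (arg_maxP (fun i => v (X ord0 i)) (erefl (xpredT (ord0 : 'I_N.+1)))) => i _ h;
     exists i => // j; exact: h.
exists i; split=> //; apply/eqP; rewrite eq_le le_bigmax andbT.
by apply: bigmax_le => [|j _]; rewrite ?av_ge0.
Qed.

Lemma unit_hcoords_ex x : unit_hcoords v x !=set0.
Proof.
case: x => L hL; have XL := memv_pick L; set X := vpick L in XL.
have X0 : X != 0 by rewrite vpick0 -dimv_eq0 (eqP hL).
have hX : hcoords (exist _ L hL : proj K N) X by [].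
have [i [_ hi]] := bigmax_norm_attained X.
have Xi0 : X ord0 i != 0.
  have [j] := hcoords_neq0 hX; rewrite -(av_gt0 v) => /lt_le_trans/(_ (hi j)).
  by rewrite av_gt0.
exists ((X ord0 i)^-1 *: X); split; first split.
- by rewrite memvZ.
- by rewrite scaler_eq0 invr_eq0 negb_or Xi0.
- apply/eqP; rewrite eq_le; apply/andP; split.
    apply: bigmax_le => [|j _]; first exact: ler01.
    by rewrite mxE avM avV mulrC ler_pdivrMr ?av_gt0 // mul1r.
  apply: le_trans (le_bigmax _ _ i).
  by rewrite mxE mulVf // av1.
Qed.

(** Taking values in the valuation ring itself makes integrality automatic and
  reduction a ring morphism. *)
Definition ucoord y i : O := insubd (0 : O) (xget 0 (unit_hcoords v y) ord0 i).

Lemma val_ucoord y i : val (ucoord y i) = xget 0 (unit_hcoords v y) ord0 i.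
Proof.
rewrite /ucoord val_insubd; have := xgetPex 0 (unit_hcoords_ex y).
set X := xget _ _ => -[hX mX]; rewrite ifT // unfold_in /integers -mX.
exact: le_bigmax.
Qed.

Lemma ucoord_hcoords y : hcoords y (\row_i val (ucoord y i)).
Proof.
have [hX _] := xgetPex 0 (unit_hcoords_ex y).
by rewrite (_ : \row_i _ = xget 0 (unit_hcoords v y)) //; apply/rowP => i; rewrite mxE val_ucoord.
Qed.

Lemma ucoord_unit y : exists i, v (val (ucoord y i)) = 1.
Proof.
have [_ mX] := xgetPex 0 (unit_hcoords_ex y).
have [i [hi _]] := bigmax_norm_attained (xget 0 (unit_hcoords v y)).
by exists i; rewrite val_ucoord -hi.
Qed.

Lemma Delta_ucoord x y i j :
  v (val (ucoord x i) * val (ucoord y j) - val (ucoord x j) * val (ucoord y i))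
    <= Delta v x y.
Proof.
rewrite /Delta !val_ucoord.
apply: le_trans (le_bigmax _ _ i).
exact: (le_bigmax _ (fun j => v (_ ord0 i * _ ord0 j - _ ord0 j * _ ord0 i)) j).
Qed.

End UnitCoordinates.

(** * Functions regular on a residue disc *)

Section ResidueMap.
Variables (R : realType) (K : fieldType) (v : absval R K).
Variables (k : fieldType) (red : {rmorphism valring v -> k}).
Hypothesis k_residue : is_residue_map red.
Local Notation O := (valring v).

Lemma red_eq0 (a : O) : (red a == 0) = (v (val a) < 1).
Proof. by apply/eqP/idP => /(k_residue.2 a). Qed.

Lemma red_unit (a : O) : (red a != 0) = (v (val a) == 1).
Proof. by rewrite red_eq0 -leNgt eq_le valring_le1. Qed.

Definition oinv (a : O) : O := insubd (0 : O) (val a)^-1.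

Lemma oinvP a : red a != 0 -> a * oinv a = 1.
Proof.
rewrite red_unit => /eqP va; have ea : val (oinv a) = (val a)^-1.
  by rewrite /oinv val_insubd ifT // unfold_in /integers avV va invr1.
apply: val_inj; change (val a * val (oinv a) = 1).
by rewrite ea mulfV // -(av_gt0 v) va.
Qed.

Lemma red_ucoord_neq0 N (y : proj K N) : exists i, red (ucoord v y i) != 0.
Proof. by have [i hi] := ucoord_unit v y; exists i; rewrite red_unit hi. Qed.

End ResidueMap.

Lemma proj_of_vector (F : fieldType) N (X : 'rV[F]_N.+1) :
  X != 0 -> exists x : proj F N, hcoords x X.
Proof.
move=> X0; have hd : \dim <[X]>%VS == 1%N by rewrite dim_vline X0.
by exists (exist _ <[X]>%VS hd); split=> //=; exact: memv_line.
Qed.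

Section RegularFunctions.
Variables (R : realType) (K : closedFieldType) (v : absval R K).
Variables (k : closedFieldType) (red : {rmorphism valring v -> k}).
Hypothesis k_residue : is_residue_map red.
Variables (N : nat).
Local Notation O := (valring v).
Local Notation P := (proj K N).
Implicit Types (D : set P) (G H : P -> O) (x y z : P).

(** The local ring of the integral model at a point of the special fibre,
  presented through the functions that its elements define on the residue
  disc [D]. *)
Inductive regular D : (P -> O) -> Prop :=
| Regular_const c : regular D (fun=> c)
| Regular_coord i j G :
    (forall y, D y -> red (ucoord v y j) != 0 /\ G y * ucoord v y j = ucoord v y i) ->
    regular D G
| Regular_add G H : regular D G -> regular D H -> regular D (fun y => G y + H y)
| Regular_mul G H : regular D G -> regular D H -> regular D (fun y => G y * H y)
| Regular_inv G H : regular D G -> (forall y, D y -> G y * H y = 1) -> regular D H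
| Regular_ext G H : (forall y, D y -> G y = H y) -> regular D G -> regular D H.

Lemma regular_sum D (I : Type) (r : seq I) (Q : pred I) (G : I -> P -> O) :
  (forall i, regular D (G i)) -> regular D (fun y => \sum_(i <- r | Q i) G i y).
Proof.
move=> hG; elim: r => [|a r IHr].
  by apply: (Regular_ext _ (Regular_const D 0)) => y _; rewrite big_nil.
have [Qa|Qa] := boolP (Q a); last first.
  by apply: (Regular_ext _ IHr) => y _; rewrite big_cons (negbTE Qa).
by apply: (Regular_ext _ (Regular_add (hG a) IHr)) => y _; rewrite big_cons Qa.
Qed.

Lemma regular_prod D (I : Type) (r : seq I) (G : I -> P -> O) :
  (forall i, regular D (G i)) -> regular D (fun y => \prod_(i <- r) G i y).
Proof.
move=> hG; elim: r => [|a r IHr].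
  by apply: (Regular_ext _ (Regular_const D 1)) => y _; rewrite big_nil.
by apply: (Regular_ext _ (Regular_mul (hG a) IHr)) => y _; rewrite big_cons.
Qed.

Lemma regular_det D n (E : P -> 'M[O]_n) :
  (forall i j, regular D (fun y => E y i j)) -> regular D (fun y => \det (E y)).
Proof.
move=> hE; apply: regular_sum => s; apply: Regular_mul; first exact: Regular_const.
by apply: regular_prod => i; exact: hE.
Qed.

Lemma regular_adj D n (E : P -> 'M[O]_n) i j :
  (forall i j, regular D (fun y => E y i j)) ->
  regular D (fun y => (\adj (E y)) i j).
Proof.
move=> hE; apply: (@Regular_ext _ (fun y => cofactor (E y) j i)).
  by move=> y _; rewrite mxE.
apply: Regular_mul; first exact: Regular_const.
apply: regular_det => i' j'.
by apply: (Regular_ext _ (hE (lift j i') (lift i j'))) => y _; rewrite !mxE.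
Qed.

Lemma regular_meval D n (g : {mpoly O[n]}) (b : 'I_n -> P -> O) :
  (forall l, regular D (b l)) -> regular D (fun y => g.@[fun l => b l y]).
Proof.
move=> hb; elim/mpoly_alg_ind: g => [c|i|g h hg hh|g h hg hh].
- by apply: (Regular_ext _ (Regular_const D c)) => y _; rewrite mevalC.
- by apply: (Regular_ext _ (hb i)) => y _; rewrite mevalXU.
- by apply: (Regular_ext _ (Regular_add hg hh)) => y _; rewrite mevalD.
- by apply: (Regular_ext _ (Regular_mul hg hh)) => y _; rewrite mevalM.
Qed.

(** Control of the reductions of the coefficients is what lets the jacobian
  criterion on the special fibre act on the whole disc. *)
Lemma regular_taylor D n (g : {mpoly O[n]}) (b : 'I_n -> P -> O) (beta : 'I_n -> k) a :
  admissible D (regular D) a -> (forall l, regular D (b l)) ->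
  (forall l y, D y -> red (b l y) = beta l) ->
  exists H : 'I_n -> P -> O,
    [/\ forall l, regular D (H l),
     forall y, D y -> g.@[fun l => b l (a y)] - g.@[fun l => b l y]
        = \sum_l (b l (a y) - b l y) * H l y
    & forall l y, D y -> red (H l y) = (map_mpoly red g)^`M(l).@[beta]].
Proof.
move=> [aD aA] hb hbeta.
have redg (g' : {mpoly O[n]}) y : D y ->
    red g'.@[fun l => b l y] = (map_mpoly red g').@[beta].
  by move=> hy; rewrite -meval_map; apply: meval_eq => l; rewrite hbeta.
elim/mpoly_alg_ind: g => [c|i|g h [G [hG eG rG]] [H [hH eH rH]]|g h [G [hG eG rG]] [H [hH eH rH]]].
- exists (fun _ _ => 0); split=> [l|y _|l y _]; first exact: Regular_const.
    by rewrite !mevalC subrr big1 // => l _; rewrite mulr0.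
  by rewrite map_mpolyC ?rmorph0 // mderivC meval0.
- exists (fun l _ => (i == l)%:R); split=> [l|y _|l y _]; first exact: Regular_const.
    rewrite !mevalXU (bigD1 i) //= eqxx mulr1 big1 ?addr0 // => l li.
    by rewrite eq_sym (negbTE li) mulr0.
  rewrite map_mpolyX mderivX rmorph_nat mevalZ mnm1E; case: eqP => [->|_].
    have -> : (U_(l) - U_(l) = 0 :> 'X_{1..n})%MM.
      by apply/mnmP => j; rewrite mnmBE subnn mnm0E.
    by rewrite mul1r mpolyX0 meval1.
  by rewrite mul0r.
- exists (fun l y => G l y + H l y); split=> [l|y hy|l y hy].
  + exact: Regular_add.
  + rewrite !mevalD opprD addrACA eG // eH // -big_split /=.
    by apply: eq_bigr => l _; rewrite mulrDr.
  + by rewrite rmorphD /= rG // rH // rmorphD /= mderivD mevalD.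
- pose gy y := g.@[fun l => b l y]; pose hy' y := h.@[fun l => b l y].
  have reg_h : regular D (hy' \o a) by apply: aA; exact: regular_meval.
  have reg_g : regular D gy by exact: regular_meval.
  exists (fun l y => G l y * hy' (a y) + gy y * H l y); split=> [l|y hy|l y hy].
  + by apply: Regular_add; apply: Regular_mul.
  + rewrite !mevalM -/(gy _) -/(hy' _).
    have -> : gy (a y) * hy' (a y) - gy y * hy' y
      = (gy (a y) - gy y) * hy' (a y) + gy y * (hy' (a y) - hy' y) by ring.
    rewrite eG // eH // big_distrl big_distrr -big_split /=.
    by apply: eq_bigr => l _; ring.
  + have rh : red (hy' (a y)) = (map_mpoly red h).@[beta] := redg h _ (aD y hy).
    have rg : red (gy y) = (map_mpoly red g).@[beta] := redg g _ hy.
    rewrite rmorphD !rmorphM /= rG // rH // rh rg.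
    by rewrite mderivM mevalD !mevalM.
Qed.

End RegularFunctions.

(** * Residue discs of a curve with good reduction *)

Section ResidueDisc.
Variables (R : realType) (K : closedFieldType) (v : absval R K).
Variables (k : closedFieldType) (red : {rmorphism valring v -> k}).
Hypothesis k_residue : is_residue_map red.
Variables (N : nat) (C : curve K N).
Local Notation O := (valring v).
Local Notation P := (proj K N).
Local Notation U y i := (ucoord v y i).
Implicit Types (G H : P -> O) (x y z : P).

Definition residue_class (xi : proj k N) : set P :=
  [set y | C y /\ hcoords xi (\row_i red (U y i))].

Lemma residue_class_exists y : C y -> exists xi, residue_class xi y.
Proof.
move=> Cy; have [|xi hxi] := @proj_of_vector _ _ (\row_i red (U y i)).
  have [i hi] := red_ucoord_neq0 k_residue y.
  by apply: contraNneq hi => /rowP/(_ i); rewrite !mxE => ->.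
by exists xi.
Qed.

Lemma residue_class_uniq xi xi' y : residue_class xi y -> residue_class xi' y -> xi = xi'.
Proof. by move=> [_ h] [_ h']; exact: hcoords_inj h h'. Qed.

Lemma Delta_lt1_residue_class xi x y : residue_class xi x -> C y -> Delta v x y < 1 ->
  residue_class xi y.
Proof.
move=> hx Cy hD; have [xi' hy] := residue_class_exists Cy.
suff -> : xi = xi' by [].
apply: (proj_eq hx.2 hy.2) => i j; rewrite !mxE; apply/eqP.
rewrite -subr_eq0 -!rmorphM -rmorphB (red_eq0 k_residue) rmorphB !rmorphM.
exact: le_lt_trans (Delta_ucoord v x y i j) hD.
Qed.

Lemma residue_class_reduced xi y : residue_class xi y -> reduced_curve red C xi.
Proof.
move=> [Cy hy] g hg Z hZ; have [tau tau0 ->] := hcoordsE hy hZ.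
have [w hw] := k_residue.1 tau.
have -> : (map_mpoly red g).@[(tau *: \row_i red (U y i)) ord0]
    = red g.@[fun i => w * U y i].
  by rewrite -meval_map; apply: meval_eq => i; rewrite !mxE rmorphM hw.
suff -> : g.@[fun i => w * U y i] = 0 by rewrite rmorph0.
apply: val_inj; rewrite -meval_map rmorph0.
have w0 : val w != 0.
  by apply: contraNneq tau0 => w0; rewrite -hw (red_eq0 k_residue) w0 av0.
move/videalP: hg => /(_ y Cy _ (hcoordsZ (ucoord_hcoords v y) w0)) <-.
by apply: meval_eq => i; rewrite !mxE rmorphM.
Qed.

Section Chart.
Variables (xi : proj k N) (Xi : 'rV[k]_N.+1) (j0 : 'I_N.+1).
Hypotheses (hXi : hcoords xi Xi) (Xij0 : Xi ord0 j0 != 0).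
Local Notation D := (residue_class xi).
Local Notation regular := (regular red D).

Definition affine i y : O := U y i * oinv (U y j0).

Lemma residue_class_red y : D y -> exists2 s, s != 0 & forall i, red (U y i) = s * Xi ord0 i.
Proof.
move=> [_ hy]; have [s s0 e] := hcoordsE hXi hy; exists s => // i.
by move/rowP: e => /(_ i); rewrite !mxE.
Qed.

Lemma chart_unit y : D y -> red (U y j0) != 0.
Proof. by move=> /residue_class_red[s s0 ->]; rewrite mulf_neq0. Qed.

Lemma chart_neq0 y : D y -> U y j0 != 0.
Proof. by move=> /chart_unit; apply: contraNneq => ->; rewrite rmorph0. Qed.

Lemma affineE i y : D y -> affine i y * U y j0 = U y i.
Proof.
by move=> /chart_unit hy; rewrite /affine mulrAC -mulrA (oinvP k_residue) // mulr1.
Qed.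

Lemma affine_chart y : D y -> affine j0 y = 1.
Proof. by move=> /chart_unit hy; rewrite /affine (oinvP k_residue). Qed.

Lemma affine_regular i : regular (affine i).
Proof.
by apply: (@Regular_coord _ _ _ _ _ _ _ i j0) => y hy; rewrite affineE // chart_unit.
Qed.

Lemma red_affine i y : D y -> red (affine i y) = Xi ord0 i / Xi ord0 j0.
Proof.
move=> hy; apply: (mulIf (chart_unit hy)); rewrite -rmorphM affineE //.
have [s s0 e] := residue_class_red hy; rewrite !e.
by rewrite mulrCA divfK.
Qed.

Lemma affine_hcoords y : D y -> hcoords y (\row_i val (affine i y)).
Proof.
move=> hy; have h0 : val (U y j0) != 0 := chart_neq0 hy.
have := hcoordsZ (ucoord_hcoords v y) (_ : (val (U y j0))^-1 != 0).
rewrite invr_eq0 => /(_ h0); congr hcoords; apply/rowP => i.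
by rewrite !mxE -(affineE i hy) rmorphM mulrC mulfK.
Qed.

Lemma affine_inj y z : D y -> D z -> (forall i, affine i y = affine i z) -> y = z.
Proof.
move=> hy hz e; apply: (hcoords_inj (affine_hcoords hy)).
rewrite (_ : \row_i _ = \row_i val (affine i z)); first exact: affine_hcoords.
by apply/rowP => i; rewrite !mxE e.
Qed.

Lemma affine_Delta i x y : D x -> D y -> v (val (affine i y - affine i x)) <= Delta v x y.
Proof.
move=> hx hy; have vj z : D z -> v (val (U z j0)) = 1.
  by move=> /chart_unit; rewrite (red_unit k_residue) => /eqP.
apply: le_trans (Delta_ucoord v x y j0 i).
rewrite -[X in X <= _]mulr1 -(vj x hx) -[X in X <= _]mulr1 -(vj y hy) -!avM.
rewrite -!rmorphM -rmorphB.
rewrite -(affineE i hx) -[in leRHS](affineE i hy).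
rewrite le_eqVlt; apply/orP; left; apply/eqP; congr (v (val _)); ring.
Qed.


Variables (t : nat) (f : 'I_t -> {mpoly O[N.+1]}).
Hypothesis f_gen : generated_by_forms (integral_ideal v C) f.

Local Notation aff y := (fun l => affine (lift j0 l) y).

Lemma chart_equations i y : D y -> (dehom j0 (f i)).@[aff y] = 0.
Proof.
move=> hy; rewrite (@meval_dehom _ _ _ _ (affine^~ y)) ?affine_chart //.
apply: val_inj; rewrite -meval_map rmorph0.
have /videalP/(_ y hy.1 _ (affine_hcoords hy)) <- : integral_ideal v C (f i).
  apply/(f_gen.2 (f i)); exists (fun j => (j == i)%:R).
  by rewrite (bigD1 i) //= eqxx mul1r big1 ?addr0 // => j /negbTE->; rewrite mul0r.
by apply: meval_eq => l; rewrite mxE.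
Qed.

Hypothesis nonsing : nonsingular_at red f xi.

(** A linear form independent of the gradients of the equations at the point
  of the special fibre is a parameter of the whole residue disc: adjoining it
  to the Taylor expansions of the equations gives a linear system for the
  increments of the coordinates, invertible modulo the maximal ideal. *)
Lemma chart_parameter : (0 < N)%N -> exists c : 'I_N -> O,
  let u y := \sum_l c l * affine (lift j0 l) y in
  forall a, admissible D regular a -> forall i, exists2 H, regular H &
    forall y, D y -> affine i (a y) - affine i y = (u (a y) - u y) * H y.
Proof.
move=> N0; pose beta (l : 'I_N) := Xi ord0 (lift j0 l) / Xi ord0 j0.
have := nonsing hXi Xij0.
set M := \matrix_(i, j) _ => rkM.
(* The rank is [N - 1], so that some row is missing from the row space. *)
have [g gM] : exists g : 'rV[k]_N, ~~ (g <= M)%MS.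
  apply: contrapT => h; have : row_full M.
    rewrite -sub1mx; apply/row_subP => i; apply: contrapT => hi.
    by apply: h; exists (row i 1%:M); apply/negP.
  by rewrite /row_full rkM; lia.
have full : row_full (col_mx M g).
  have lt : (M < col_mx M g)%MS.
    by rewrite ltmxE -addsmxE addsmxSl -addsmxE addsmx_sub submx_refl.
  by move: (rank_ltmx lt) (rank_leq_col (col_mx M g)); rewrite rkM /row_full; lia.
have [B hB] := row_fullP full.
have [lf hlf] := choice k_residue.1.
pose Bt : 'M[O]_(N, t + 1) := \matrix_(i, j) lf (B i j).
pose ct : 'rV[O]_N := \row_l lf (g ord0 l).
have redB : map_mx red Bt = B by apply/matrixP => i j; rewrite !mxE hlf.
have redc : map_mx red ct = g by apply/rowP => l; rewrite !mxE hlf.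
exists (fun l => ct ord0 l) => u a ha i; have [aD _] := ha.
case: (unliftP j0 i) => [l ->|->]; last first.
  exists (fun=> 0); first exact: Regular_const.
  by move=> y hy; rewrite !affine_chart ?subrr ?mulr0 //; exact: aD.
have [H hH] := choice (fun i => regular_taylor (dehom j0 (f i))
  (b := fun l => affine (lift j0 l)) (beta := beta) ha (fun l => affine_regular (lift j0 l))
  (fun l y hy => red_affine (lift j0 l) hy)).
pose E y : 'M[O]_N := Bt *m col_mx (\matrix_(i, l) H i l y) ct.
have regE i' j' : regular (fun y => E y i' j').
  apply: (@Regular_ext _ _ _ _ _ _ _ (fun y => \sum_s Bt i' s *
    (match split s with inl s' => H s' j' y | inr s' => ct s' j' end))).
    by move=> y _; rewrite mxE; apply: eq_bigr => s _; congr (_ * _);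
       rewrite mxE; case: (split s) => s'; rewrite ?mxE.
  apply: regular_sum => s; apply: Regular_mul; first exact: Regular_const.
  by case: (split s) => s'; [case: (hH s')|exact: Regular_const].
have redE y : D y -> map_mx red (E y) = 1%:M.
  move=> hy; rewrite map_mxM redB map_col_mx redc -[RHS]hB; congr (_ *m col_mx _ _).
  by apply/matrixP => i' l'; rewrite !mxE; have [_ _ ->] := hH i'.
have redD y : D y -> red (\det (E y)) = 1.
  by move=> hy; rewrite -det_map_mx redE // det1.
(* The equations contribute [0] to the right-hand side of the system, the
   parameter contributes its increment. *)
pose b : 'cV[O]_N := Bt *m col_mx 0 1%:M.
pose dl y : 'cV[O]_N := \col_l (affine (lift j0 l) (a y) - affine (lift j0 l) y).
have eqE y : D y -> E y *m dl y = (u (a y) - u y) *: b.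
  move=> hy; rewrite /E /b -mulmxA mul_col_mx scalemxAr; congr (_ *m _).
  rewrite scale_col_mx scaler0; congr col_mx.
    apply/matrixP => i' j'; rewrite !mxE.
    have [_ + _] := hH i' => /(_ y hy).
    rewrite !chart_equations ?subrr //; last exact: aD.
    by move=> e; rewrite [RHS]e; apply: eq_bigr => l' _; rewrite !mxE mulrC.
  apply/matrixP => i' j'; rewrite !ord1 !mxE eqxx mulr1 /u -sumrB.
  by apply: eq_bigr => l' _; rewrite !mxE mulrBr.
exists (fun y => oinv (\det (E y)) * (\adj (E y) *m b) l ord0).
  apply: Regular_mul.
    apply: (Regular_inv (regular_det regE)) => y hy.
    by rewrite (oinvP k_residue) // redD // oner_neq0.
  apply: (@Regular_ext _ _ _ _ _ _ _ (fun y => \sum_s (\adj (E y)) l s * b s ord0)).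
    by move=> y _; rewrite mxE.
  apply: regular_sum => s; apply: Regular_mul; last exact: Regular_const.
  exact: regular_adj.
move=> y hy.
have key : \det (E y) * dl y l ord0 = (u (a y) - u y) * (\adj (E y) *m b) l ord0.
  have : \adj (E y) *m (E y *m dl y) = \adj (E y) *m ((u (a y) - u y) *: b) by rewrite eqE.
  by rewrite mulmxA mul_adj_mx mul_scalar_mx -scalemxAr => /matrixP/(_ l ord0);
     rewrite mxE => ->; rewrite mxE.
rewrite mulrCA -key mulrA [_ * \det _]mulrC (oinvP k_residue) ?mul1r ?mxE //.
by rewrite redD // oner_neq0.
Qed.


(** Divisibility of increments passes through all the constructions of regular
  functions; only the coordinates need the parameter. *)
Lemma regular_div u a G : regular u -> admissible D regular a ->
  (forall i, exists2 H, regular H &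
    forall y, D y -> affine i (a y) - affine i y = (u (a y) - u y) * H y) ->
  regular G -> exists2 H, regular H &
    forall y, D y -> G (a y) - G y = (u (a y) - u y) * H y.
Proof.
move=> hu [aD aA] haff.
pose divisible G := exists2 H, regular H &
  forall y, D y -> G (a y) - G y = (u (a y) - u y) * H y.
have div_mul G1 G2 : regular G1 -> regular G2 ->
    divisible G1 -> divisible G2 -> divisible (fun y => G1 y * G2 y).
  move=> r1 r2 [H1 h1 e1] [H2 h2 e2].
  exists (fun y => H1 y * G2 (a y) + G1 y * H2 y) => [|y hy].
    by apply: Regular_add; apply: Regular_mul => //; exact: aA.
  have -> : G1 (a y) * G2 (a y) - G1 y * G2 y
    = (G1 (a y) - G1 y) * G2 (a y) + G1 y * (G2 (a y) - G2 y) by ring.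
  by rewrite e1 // e2 //; ring.
have div_inv G1 G2 : regular G2 -> divisible G1 ->
    (forall y, D y -> G1 y * G2 y = 1) -> divisible G2.
  move=> r2 [H1 h1 e1] h; exists (fun y => - 1 * (H1 y * (G2 (a y) * G2 y))) => [|y hy].
    apply: Regular_mul; first exact: Regular_const.
    by apply: Regular_mul => //; apply: Regular_mul => //; exact: aA.
  have -> : G2 (a y) - G2 y = - (G1 (a y) - G1 y) * (G2 (a y) * G2 y).
    have -> : - (G1 (a y) - G1 y) * (G2 (a y) * G2 y)
      = (G1 y * G2 y) * G2 (a y) - (G1 (a y) * G2 (a y)) * G2 y by ring.
    by rewrite !h ?mul1r //; exact: aD.
  by rewrite e1 //; ring.
have div_ext G1 G2 : (forall y, D y -> G1 y = G2 y) -> divisible G1 -> divisible G2.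
  move=> e [H h eH]; exists H => // y hy.
  by rewrite -!e ?eH //; exact: aD.
elim=> {G} [c|i j G hG|G H rG dG rH dH|G H rG dG rH dH|G H rG dG h|G H e rG dG].
- by exists (fun=> 0); [exact: Regular_const|move=> y _; rewrite subrr mulr0].
- have unit_j y : D y -> red (affine j y) != 0.
    move=> hy; have [hj _] := hG y hy; apply: contraNneq hj => e.
    by rewrite -(affineE j hy) rmorphM e mul0r.
  have inv_j y : D y -> affine j y * oinv (affine j y) = 1.
    by move=> /unit_j /(oinvP k_residue).
  have reg_inv : regular (fun y => oinv (affine j y)).
    exact: (Regular_inv (affine_regular j) inv_j).
  apply: (div_ext (fun y => affine i y * oinv (affine j y))).
    move=> y hy; have [_ e] := hG y hy.
    rewrite -[G y]mulr1 -(inv_j y hy) mulrA; congr (_ * _).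
    apply: (valring_mulfI (chart_neq0 hy)).
    by rewrite [LHS]mulrC affineE // mulrCA [U y j0 * _]mulrC affineE.
  by apply: div_mul => //; [exact: affine_regular|exact: (div_inv (affine j))].
- case: dG => G' rG' eG; case: dH => H' rH' eH.
  exists (fun y => G' y + H' y) => [|y hy]; first exact: Regular_add.
  by rewrite opprD addrACA eG // eH // mulrDr.
- exact: div_mul.
- by apply: (div_inv G) => //; exact: (Regular_inv rG h).
- exact: (div_ext G).
Qed.

Lemma residue_disc_ring_chart : (0 < N)%N -> exists u, disc_ring D regular u /\
  forall x y, D x -> D y -> v (val (u y - u x)) <= Delta v x y.
Proof.
move=> N0; have [c hc] := chart_parameter N0.
set u := fun y => \sum_l c l * affine (lift j0 l) y.
have reg_u : regular u.
  apply: regular_sum => l; apply: Regular_mul; first exact: Regular_const.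
  exact: affine_regular.
exists u; split; last first.
  move=> x y hx hy; rewrite /u -sumrB rmorph_sum.
  apply: av_sum_le => [|l].
    exact: le_trans (av_ge0 _ _) (affine_Delta j0 hx hy).
  apply: le_trans (affine_Delta (lift j0 l) hx hy).
  by rewrite -mulrBr rmorphM avM ler_piMl ?av_ge0 ?valring_le1.
split=> //.
- exact: Regular_const.
- exact: Regular_add.
- exact: Regular_mul.
- exact: Regular_ext.
- move=> y z hy hz; rewrite -(red_eq0 k_residue) rmorphB subr_eq0; apply/eqP.
  by rewrite /u !rmorph_sum; apply: eq_bigr => l _; rewrite 2!(rmorphM red (c l)) !red_affine.
- move=> y z hy hz e; apply: affine_inj => // i.
  have [|H _ eH] := hc (fun=> z) _ i.
    by split=> // G _; exact: Regular_const.
  by have := eH y hy; rewrite -!/(u _) e subrr mul0r => /eqP; rewrite subr_eq0 => /eqP.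
- by move=> a G ha rG; apply: regular_div => // i; exact: hc.
Qed.

End Chart.

Lemma residue_disc_ring t (f : 'I_t -> {mpoly O[N.+1]}) xi x :
  generated_by_forms (integral_ideal v C) f -> curve_good_reduction red C f ->
  (0 < N)%N -> residue_class xi x ->
  exists u, disc_ring (residue_class xi) (regular red (residue_class xi)) u /\
  forall y z, residue_class xi y -> residue_class xi z ->
    v (val (u z - u y)) <= Delta v y z.
Proof.
move=> f_gen C_good N0 hx; have [j0 hj0] := hcoords_neq0 hx.2.
exact: (residue_disc_ring_chart hx.2 hj0 f_gen (C_good _ (residue_class_reduced hx))).
Qed.

Variable phi : self_morphism C.
Hypothesis phi_good : mor_good_reduction red phi.

(** Around a point of the special fibre, a single integral representation with
  nonzero reduction computes the morphism on the whole disc, and the quotients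
  of its components are regular there. *)
Lemma morphism_residue_pullback xi xi' y0 :
  residue_class xi y0 -> residue_class xi' (phi y0) ->
  (forall y, residue_class xi y -> residue_class xi' (phi y)) /\
  (forall G, regular red (residue_class xi') G ->
     regular red (residue_class xi) (G \o phi)).
Proof.
move=> hy0 hphi0; set D := residue_class xi; set D' := residue_class xi'.
have [j0 hj0] := hcoords_neq0 hy0.2; set Xi := \row_i _ in hj0.
have hXi : hcoords xi Xi := hy0.2.
have [G repG hG] := phi_good (residue_class_reduced hy0).
pose w i y := (G i).@[fun l => affine j0 l y].
pose gam i := (map_mpoly red (G i)).@[((Xi ord0 j0)^-1 *: Xi) ord0].
have reg_w i : regular red D (w i).
  by apply: regular_meval => l; exact: (affine_regular hXi hj0).
have red_w i y : D y -> red (w i y) = gam i.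
  move=> hy; rewrite /w -meval_map; apply: meval_eq => l.
  by rewrite (red_affine hXi hj0) // !mxE mulrC.
have [i1 gam1] : exists i, gam i != 0.
  by apply: hG; apply: hcoordsZ hXi _; rewrite invr_eq0.
have w_hcoords y : D y -> hcoords (phi y) (\row_i val (w i y)).
  move=> hy; have := represents_hcoords repG hy.1 (affine_hcoords hXi hj0 hy).
  have -> : eval_forms [ffun i => map_mpoly val (G i)] (\row_i val (affine j0 i y))
      = \row_i val (w i y).
    apply/rowP => i; rewrite !mxE ffunE /w -meval_map.
    by apply: meval_eq => l; rewrite mxE.
  apply; apply: contraNneq gam1 => /rowP/(_ i1); rewrite !mxE => e.
  by rewrite -(red_w i1 y hy) (red_eq0 k_residue) e av0.
have prop y i j : D y -> U (phi y) i * w j y = U (phi y) j * w i y.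
  move=> hy; have [s _ e] := hcoordsE (w_hcoords y hy) (ucoord_hcoords v (phi y)).
  have eU l : val (U (phi y) l) = s * val (w l y).
    by move/rowP: e => /(_ l); rewrite !mxE.
  apply: val_inj.
  change (val (U (phi y) i) * val (w j y) = val (U (phi y) j) * val (w i y)).
  by rewrite !eU; ring.
have red_prop y i : D y -> red (U (phi y) i) * gam i1 = red (U (phi y) i1) * gam i.
  by move=> hy; rewrite -!(red_w _ y hy) -!rmorphM prop.
have red_i1 y : D y -> red (U (phi y) i1) != 0.
  move=> hy; have [i hi] := red_ucoord_neq0 k_residue (phi y).
  by have := mulf_neq0 hi gam1; rewrite red_prop // mulf_eq0 negb_or => /andP[].
have Dphi y : D y -> D' (phi y).
  move=> hy; have Cphi : C (phi y) by apply: mor_stable; case: hy.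
  have [xi2 h2] := residue_class_exists Cphi.
  rewrite /D'; suff -> : xi' = xi2 by [].
  apply: (proj_eq hphi0.2 h2.2) => i j; rewrite !mxE.
  apply: (mulIf gam1); apply: (mulIf gam1).
  have sw a b c d : a * b * c * d = (a * c) * (b * d) :> k by ring.
  by rewrite !sw !red_prop //; ring.
split=> // H; elim=> {H} [c|i j H hH|H1 H2 _ r1 _ r2|H1 H2 _ r1 _ r2|H1 H2 _ r1 h|H1 H2 e _ r1].
- exact: Regular_const.
- have gam_j y : D y -> gam j != 0.
    move=> hy; have [hj _] := hH _ (Dphi y hy).
    by have := mulf_neq0 hj gam1; rewrite red_prop // mulf_eq0 negb_or => /andP[].
  have inv_j y : D y -> w j y * oinv (w j y) = 1.
    by move=> hy; rewrite (oinvP k_residue) // red_w // (gam_j y).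
  apply: (@Regular_ext _ _ _ _ _ _ _ (fun y => w i y * oinv (w j y))) => [y hy|].
    have [hj e] := hH _ (Dphi y hy); rewrite /= -[H _]mulr1 -(inv_j y hy) mulrA.
    congr (_ * _); apply: (@valring_mulfI _ _ _ (U (phi y) j)).
      by apply: contraNneq hj => ->; rewrite rmorph0.
    by rewrite mulrA [_ * H _]mulrC e -prop.
  by apply: Regular_mul => //; exact: (Regular_inv (reg_w j) inv_j).
- exact: Regular_add.
- exact: Regular_mul.
- by apply: (Regular_inv r1) => y hy; exact/h/Dphi.
- by apply: (Regular_ext _ r1) => y hy; exact/e/Dphi.
Qed.

End ResidueDisc.

(** * Periodic points in a residue disc *)

(** If an earlier iterate returned to [y], the orbit would have fewer than [n]
  elements. *)
Lemma least_period_exact (T : Type) (phi : T -> T) y n :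
  least_period phi y n -> exact_period phi y n.
Proof.
move=> [n0 hn card]; split=> // j /andP[j0 jn] hj.
suff : (n <= j)%N by rewrite leqNgt jn.
rewrite -card_le_II -(card_le_eql card).
apply: card_le_trans (card_image_le (fun m => iter m phi y) `I_j).
apply: subset_card_le => _ [m _ <-]; exists (m %% j)%N; first exact: ltn_pmod.
rewrite [in RHS](divn_eq m j) addnC iterD; congr (iter _ phi _).
by rewrite iterM iter_fix.
Qed.

Lemma padic_norm_nat (R : realType) p (K : closedFieldType) (v : absval R K) n :
  is_Qpbar p v -> (0 < n)%N -> v n%:R = p%:R ^- logn p n.
Proof.
move=> [Q [w [iota [[hw _ _] hv _]]]] n0.
have -> : n%:R = iota (ratr (n%:R : rat)) :> K by rewrite ratr_nat rmorph_nat.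
rewrite hv hw /padic_abs pnatr_eq0 (gtn_eqF n0).
have -> : (n%:R : rat) = (n%:Z)%:Q by [].
by rewrite numq_int denq_int absz1 logn1 sub0r exprnN.
Qed.

Lemma disc_ring_shift (R : realType) (F : fieldType) (v : absval R F) T
    (D : set T) (A : (T -> valring v) -> Prop) u x0 :
  disc_ring D A u -> disc_ring D A (fun y => u y - u x0).
Proof.
move=> disc; have shift y z : (u y - u x0) - (u z - u x0) = u y - u z by ring.
split; first exact: dr_const disc.
- exact: dr_add disc.
- exact: dr_mul disc.
- exact: dr_ext disc.
- exact: (dr_sub disc (dr_par disc) (dr_const disc (u x0))).
- by move=> y z hy hz; rewrite shift; exact: dr_lt1 disc _ _ hy hz.
- by move=> y z hy hz /addIr; exact: dr_inj disc _ _ hy hz.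
- move=> a G ha hG; have [H hH e] := dr_div disc ha hG.
  by exists H => // z hz; rewrite shift e.
Qed.

Section PeriodicPoints.
Variables (R : realType) (p : nat) (p_prime : prime p).
Variables (K : closedFieldType) (v : absval R K) (K_Qpbar : is_Qpbar p v).
Variables (k : closedFieldType) (red : {rmorphism valring v -> k}).
Hypothesis k_residue : is_residue_map red.
Variables (N : nat) (C : curve K N) (phi : self_morphism C).
Hypothesis phi_good : mor_good_reduction red phi.
Implicit Types (x y z : proj K N).

Local Notation cls := (residue_class red C).

Lemma iter_residue_pullback m xi xi' y0 : cls xi y0 -> cls xi' (iter m phi y0) ->
  (forall y, cls xi y -> cls xi' (iter m phi y)) /\
  (forall G, regular red (cls xi') G -> regular red (cls xi) (G \o iter m phi)).
Proof.
elim: m xi' => [|m IHm] xi' h0 hm.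
  by rewrite (residue_class_uniq hm h0).
have Cm : C (iter m phi y0) by apply: iter_stable; case: h0.
have [xi1 h1] := residue_class_exists k_residue Cm.
have [D1 A1] := IHm xi1 h0 h1.
have [D2 A2] := morphism_residue_pullback k_residue phi_good h1 hm.
split=> [y /D1/D2//|G /A2/A1]; exact.
Qed.

Lemma padic_norm_prime : v p%:R = p%:R^-1.
Proof.
by rewrite (padic_norm_nat K_Qpbar (prime_gt0 p_prime)) logn_prime // eqxx.
Qed.

Lemma padic_norm_coprime e : ~~ (p %| e)%N -> v e%:R = 1.
Proof.
move=> pe; rewrite (padic_norm_nat K_Qpbar); last first.
  by case: e pe => //; rewrite dvdn0.
by rewrite lognE (negbTE pe) !andbF expr0 invr1.
Qed.

Variables (d : nat) (d_gt1 : (1 < d)%N) (phi_deg : mor_degree phi d).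
Variables (xi : proj k N) (u : proj K N -> valring v).
Hypothesis disc : disc_ring (cls xi) (regular red (cls xi)) u.

Local Notation rho y x := (v (val (u y - u x))).

(** The exponent [n], the period under the morphism, replaces the period [r]
  under the iterate [phi^m] fixing the centre: as [n <= r * m] and [m] is
  fixed, this only raises the constant to the power [m]. *)
Lemma residue_class_bound x : cls xi x ->
  exists2 c : R, 0 < c & forall y n, cls xi y -> y <> x -> exact_period phi y n ->
    c <= rho y x ^+ n.
Proof.
move=> Dx.
have rho_gt0 y : cls xi y -> y <> x -> 0 < rho y x.
  move=> hy yx; rewrite valring_gt0 subr_eq0; apply/eqP => e.
  exact: yx (dr_inj disc hy Dx e).
have rho_le1 y : rho y x <= 1 by exact: valring_le1.
have [[x0 [m [Dx0 m0 hm hx]]]|hno] := pselect (exists x0 m, [/\ cls xi x0, (0 < m)%N,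
    iter m phi x0 = x0 & x = x0 \/ forall r, (0 < r)%N -> iter r phi x <> x]);
  last first.
  exists 1 => // y n hy yx [n0 hyn _]; case: hno.
  have [[r [r0 hr]]|hr] := pselect (exists r, (0 < r)%N /\ iter r phi x = x).
    by exists x, r; split=> //; left.
  exists y, n; split=> //; right=> r r0 e; apply: hr; by exists r.
have adm : admissible (cls xi) (regular red (cls xi)) (iter m phi).
  by apply: (iter_residue_pullback Dx0); rewrite hm.
have bound_pow (c : R) y n q : 0 < c -> (n <= q)%N -> cls xi y -> y <> x ->
    c <= rho y x -> Num.min c 1 ^+ q <= rho y x ^+ n.
  move=> c0 nq hy yx h; have c1 : 0 <= Num.min c 1 <= 1.
    by rewrite le_min (ltW c0) ler01 ge_min lexx orbT.
  apply: le_trans (_ : Num.min c 1 ^+ n <= _).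
    by case/andP: c1 => ? ?; exact: ler_wiXn2l.
  case/andP: c1 => ? ?.
  by apply: lerXn2r; rewrite ?nnegrE ?av_ge0 // (le_trans _ h) // ge_min lexx.
have [[s [s0 hs]]|hinf] := pselect (exists s, (0 < s)%N /\
    forall z, cls xi z -> iter s (iter m phi) z = z).
  have fin : finite_set (cls xi).
    apply: contrapT => inf; move: d_gt1; rewrite ltnNge => /negP[].
    apply: (finite_order_degree_le1 (M := (s * m)%N) _ _ phi_deg).
      by rewrite muln_gt0 s0.
    apply: contra_not inf; apply: sub_finite_set => z hz.
    by split; [case: hz|rewrite iterM hs].
  have finS : finite_set (cls xi `&` [set y | y <> x]).
    by apply: sub_finite_set fin => y [].
  have [c c0 hc] := finite_positive_lower_bound finS
    (fun y (hy : _ /\ _) => rho_gt0 y hy.1 hy.2).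
  exists (Num.min c 1 ^+ (s * m)); first by rewrite exprn_gt0 // lt_min c0 ltr01.
  move=> y n hy yx [n0 hyn hmin]; apply: bound_pow => //; last by apply: hc; split.
  rewrite leqNgt; apply/negP => h; apply: (hmin (s * m)%N); first by rewrite muln_gt0 s0 m0 h.
  by rewrite iterM hs.
have hinf' s : (0 < s)%N -> exists2 z, cls xi z & iter s (iter m phi) z <> z.
  move=> s0; apply: contrapT => h; apply: hinf; exists s; split=> // z hz.
  by apply: contrapT => hz'; apply: h; exists z.
have xper : x = x0 \/ forall r, (0 < r)%N -> iter r (iter m phi) x <> x.
  case: hx => [|hx]; [by left|right=> r r0].
  by rewrite -iterM; apply: hx; rewrite muln_gt0 r0.
have vp0 : 0 < v p%:R by rewrite padic_norm_prime invr_gt0 ltr0n prime_gt0.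
have vp1 : v p%:R < 1 by rewrite padic_norm_prime invf_lt1 ?ltr0n ?ltr1n ?prime_gt0 ?prime_gt1.
have [c c0 hc] := dr_periodic_bound (disc_ring_shift x0 disc) Dx0 (subrr _) adm hm
  (prime_gt1 p_prime) vp0 vp1 padic_norm_coprime Dx xper hinf'.
exists (Num.min c 1 ^+ m); first by rewrite exprn_gt0 // lt_min c0 ltr01.
move=> y n hy yx [n0 hyn hmin].
have [r per rn] : exists2 r, exact_period (iter m phi) y r & (r <= n)%N.
  by apply: exact_period_exists n0 _; rewrite -iterM mulnC iterM iter_fix.
have nrm : (n <= r * m)%N.
  have [r0 hr _] := per; rewrite leqNgt; apply/negP => h.
  by apply: (hmin (r * m)%N); rewrite ?iterM // muln_gt0 r0 m0 h.
have := hc y r hy yx per; rewrite opprB addrA addrNK => h.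
apply: le_trans (_ : (rho y x ^+ r) ^+ m <= _).
  apply: lerXn2r; rewrite ?nnegrE ?exprn_ge0 ?av_ge0 ?le_min ?(ltW c0) ?ler01 //.
  by apply: le_trans h; rewrite ge_min lexx.
by rewrite -exprM; apply: ler_wiXn2l; rewrite ?av_ge0.
Qed.

End PeriodicPoints.

Lemma proj0_eq (F : fieldType) (x y : proj F 0) : x = y.
Proof.
case: x y => [L hL] [L' hL']; apply: val_inj => /=.
have full (M : {vspace 'rV[F]_1}) : \dim M == 1%N -> M = fullv.
  by move=> hM; apply/eqP; rewrite eqEdim subvf dimvf /dim /= (eqP hM).
by rewrite (full L hL) (full L' hL').
Qed.

Theorem theorem1 (R : realType) (p : nat) (p_prime : prime p)
    (K : closedFieldType) (v : absval R K) (K_Qpbar : is_Qpbar p v)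
    (k : closedFieldType) (red : {rmorphism valring v -> k})
    (k_residue : is_residue_map red)
    (N : nat) (C : curve K N)
    (t : nat) (f : 'I_t -> {mpoly (valring v)[N.+1]})
    (f_gen : generated_by_forms (integral_ideal v C) f)
    (C_smooth : smooth_curve C f)
    (C_good : curve_good_reduction red C f)
    (phi : self_morphism C) (phi_good : mor_good_reduction red phi)
    (d : nat) (d_gt1 : (1 < d)%N) (phi_deg : mor_degree phi d)
    (x : proj K N) (Cx : curve_pts C x) :
  exists kappa : R, 0 < kappa /\
    forall (n : nat) (y : proj K N), (1 <= n)%N -> curve_pts C y -> y <> x ->
      least_period phi y n ->
      (kappa * v n%:R) `^ n%:R^-1 <= Delta v x y.
Proof.
have [N0|Npos] := posnP N.
  exists 1; split=> // n y _ _ yx; case: yx; move: x y {Cx}.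
  by move: C f f_gen C_smooth C_good phi phi_good phi_deg; rewrite N0 => *; exact: proj0_eq.
have [xi Dx] := residue_class_exists k_residue Cx.
have [u [disc hu]] := residue_disc_ring k_residue f_gen C_good Npos Dx.
have [c c0 hc] := residue_class_bound p_prime K_Qpbar k_residue phi_good
  d_gt1 phi_deg disc Dx.
exists (Num.min c 1); split; first by rewrite lt_min c0 ltr01.
move=> n y n1 Cy yx hper; have per := least_period_exact hper.
have D0 : 0 <= Delta v x y.
  exact: le_trans (av_ge0 _ _) (Delta_ucoord v x y ord0 ord0).
have kn : Num.min c 1 * v n%:R <= Delta v x y ^+ n.
  apply: le_trans (_ : Num.min c 1 <= _).
    by rewrite ler_piMr ?av_nat_le1 // le_min (ltW c0) ler01.
  have [D1|D1] := leP 1 (Delta v x y).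
    by rewrite ge_min exprn_ege1 // orbT.
  have Dy := Delta_lt1_residue_class k_residue Dx Cy D1.
  rewrite ge_min (le_trans (hc y n Dy yx per)) //.
  by apply: lerXn2r; rewrite ?nnegrE ?av_ge0 // hu.
have -> : Delta v x y = (Delta v x y ^+ n) `^ n%:R^-1.
  by rewrite -powR_mulrn // -powRrM mulfV ?powRr1 // pnatr_eq0 -lt0n.
apply: ge0_ler_powR => //; rewrite ?nnegrE ?invr_ge0 ?exprn_ge0 //.
by rewrite mulr_ge0 ?av_ge0 // le_min (ltW c0) ler01.
Qed.
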